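(* (ZF) Suppose that the hypergraph $\Gamma_R$ has countable chromatic number. Then: (1) if there is an $\omega_1$-sequence of pairwise distinct reals, then there is an $\omega_1$-sequence of pairwise distinct reals whose range is all of $\mathbb{R}$; (2) there is a complete countable section for the equivalence relation $\mathbb{E}_1$.
   Context: $\Gamma_R$ is the hypergraph of arity four on $\mathbb{R}^2$ consisting of all sets of the form $a\times b$ where $a,b\subset\mathbb{R}$ each have exactly two elements. Countable chromatic number means there is a function $c\colon\mathbb{R}^2\to\omega$ such that no hyperedge is $c$-monochromatic. $\mathbb{E}_1$ is the equivalence relation on $\mathbb{R}^\omega$ relating $x,y$ if $\{n\colon x(n)\ne y(n)\}$ is finite; a complete countable section is a set meeting every $\mathbb{E}_1$-class in a nonempty countable set. *)

(* Defs.v *)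
(** "ZF proves A" is rendered as "A holds in every first-order structure
    [(V, ∈)] satisfying the axioms of ZF".  Every notion below is relativized to
    such a structure: all quantifiers range over elements of [V], so that "set",
    "function", "countable", ... mean what the structure believes them to mean.
    In particular choice principles available in the ambient logic say nothing
    about choice inside [V]; for this it matters that Separation and
    Replacement are the first-order schemas, not their second-order versions. *)

Record set_structure : Type := SetStructure {
  dom :> Type;
  mem : dom -> dom -> Prop
}.

Declare Scope zf_scope.
Delimit Scope zf_scope with zf.
Notation "x ∈ y" := (mem _ x y) (at level 70, no associativity) : zf_scope.
Notation "x ∉ y" := (~ mem _ x y) (at level 70, no associativity) : zf_scope.
Open Scope zf_scope.

(** * First-order formulas of the language of set theory *)

(** Variables are de Bruijn indices; [All] and [Ex] bind index 0. *)
Inductive formula : Type :=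
| Mem (i j : nat)
| Equ (i j : nat)
| Bot
| Imp (phi psi : formula)
| And (phi psi : formula)
| Or (phi psi : formula)
| All (phi : formula)
| Ex (phi : formula).

Definition scons {T : Type} (x : T) (e : nat -> T) (n : nat) : T :=
  match n with O => x | S m => e m end.

Fixpoint sat {V : set_structure} (e : nat -> V) (phi : formula) : Prop :=
  match phi with
  | Mem i j => e i ∈ e j
  | Equ i j => e i = e j
  | Bot => False
  | Imp p q => sat e p -> sat e q
  | And p q => sat e p /\ sat e q
  | Or p q => sat e p \/ sat e q
  | All p => forall x : V, sat (scons x e) p
  | Ex p => exists x : V, sat (scons x e) p
  end.

(** * Basic set-theoretic vocabulary *)

Definition subset {V : set_structure} (x y : V) : Prop :=
  forall z : V, z ∈ x -> z ∈ y.

Definition is_empty {V : set_structure} (x : V) : Prop :=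
  forall z : V, z ∉ x.

Definition is_upair {V : set_structure} (a x y : V) : Prop :=
  forall z : V, z ∈ a <-> z = x \/ z = y.

(** [p] is the Kuratowski pair [{{x}, {x, y}}]. *)
Definition is_opair {V : set_structure} (p x y : V) : Prop :=
  exists a b : V, is_upair a x x /\ is_upair b x y /\ is_upair p a b.

Definition is_prod {V : set_structure} (P A B : V) : Prop :=
  forall p : V, p ∈ P <->
    exists x y : V, x ∈ A /\ y ∈ B /\ is_opair p x y.

(** [app f x y]: the ordered pair of [x] and [y] belongs to [f]; when [f] is a
    function this says [f(x) = y]. *)
Definition app {V : set_structure} (f x y : V) : Prop :=
  exists p : V, is_opair p x y /\ p ∈ f.

Definition is_fun {V : set_structure} (f A B : V) : Prop :=
  (forall p : V, p ∈ f ->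
     exists x y : V, x ∈ A /\ y ∈ B /\ is_opair p x y) /\
  (forall x : V, x ∈ A -> exists! y : V, app f x y).

Definition injective {V : set_structure} (f : V) : Prop :=
  forall x x' y : V, app f x y -> app f x' y -> x = x'.

Definition onto {V : set_structure} (f B : V) : Prop :=
  forall y : V, y ∈ B -> exists x : V, app f x y.

Definition is_succ {V : set_structure} (s x : V) : Prop :=
  forall z : V, z ∈ s <-> z ∈ x \/ z = x.

Definition inductive_set {V : set_structure} (I : V) : Prop :=
  (exists z : V, is_empty z /\ z ∈ I) /\
  (forall n : V, n ∈ I -> exists s : V, is_succ s n /\ s ∈ I).

Definition is_omega {V : set_structure} (w : V) : Prop :=
  inductive_set w /\ forall I : V, inductive_set I -> subset w I.

Definition finite {V : set_structure} (A : V) : Prop :=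
  exists w n f : V,
    is_omega w /\ n ∈ w /\ is_fun f A n /\ injective f /\ onto f n.

(** Finite sets are countable. *)
Definition countable {V : set_structure} (A : V) : Prop :=
  exists w f : V, is_omega w /\ is_fun f A w /\ injective f.

Definition transitive_set {V : set_structure} (x : V) : Prop :=
  forall y : V, y ∈ x -> subset y x.

(** Von Neumann ordinals; by Foundation, a transitive set of transitive sets is
    well ordered by membership. *)
Definition is_ordinal {V : set_structure} (a : V) : Prop :=
  transitive_set a /\ forall b : V, b ∈ a -> transitive_set b.

Definition is_omega1 {V : set_structure} (o : V) : Prop :=
  is_ordinal o /\ ~ countable o /\ forall a : V, a ∈ o -> countable a.

(** * The axioms of ZF *)

Definition extensionality_axiom (V : set_structure) : Prop :=
  forall x y : V, (forall z : V, z ∈ x <-> z ∈ y) -> x = y.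

Definition foundation_axiom (V : set_structure) : Prop :=
  forall x : V, (exists y : V, y ∈ x) ->
    exists y : V, y ∈ x /\ forall z : V, z ∈ x -> z ∉ y.

Definition pairing_axiom (V : set_structure) : Prop :=
  forall x y : V, exists a : V, is_upair a x y.

Definition union_axiom (V : set_structure) : Prop :=
  forall a : V, exists u : V, forall x : V,
    x ∈ u <-> exists y : V, y ∈ a /\ x ∈ y.

Definition power_set_axiom (V : set_structure) : Prop :=
  forall a : V, exists p : V, forall x : V, x ∈ p <-> subset x a.

Definition infinity_axiom (V : set_structure) : Prop :=
  exists I : V, inductive_set I.

(** The environment [e] supplies the parameters of the formula. *)
Definition separation_schema (V : set_structure) : Prop :=
  forall (phi : formula) (e : nat -> V) (a : V), exists b : V,
    forall x : V, x ∈ b <-> x ∈ a /\ sat (scons x e) phi.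

(** In [phi], index 0 is the argument [x] and index 1 the value [y]. *)
Definition replacement_schema (V : set_structure) : Prop :=
  forall (phi : formula) (e : nat -> V) (a : V),
    (forall x : V, x ∈ a ->
       exists! y : V, sat (scons x (scons y e)) phi) ->
    exists b : V, forall y : V,
      y ∈ b <-> exists x : V, x ∈ a /\ sat (scons x (scons y e)) phi.

Record ZF (V : set_structure) : Prop := {
  ZF_extensionality : extensionality_axiom V;
  ZF_foundation : foundation_axiom V;
  ZF_pairing : pairing_axiom V;
  ZF_union : union_axiom V;
  ZF_power_set : power_set_axiom V;
  ZF_infinity : infinity_axiom V;
  ZF_separation : separation_schema V;
  ZF_replacement : replacement_schema V
}.

(** * The real line *)

Definition is_binop {V : set_structure} (f R : V) : Prop :=
  exists R2 : V, is_prod R2 R R /\ is_fun f R2 R.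

(** [app2 f x y z]: [f(x, y) = z]. *)
Definition app2 {V : set_structure} (f x y z : V) : Prop :=
  exists p : V, is_opair p x y /\ app f p z.

Record comm_monoid_law {V : set_structure} (R f u : V) : Prop := {
  cml_assoc : forall x y z xy yz s : V,
    app2 f x y xy -> app2 f y z yz -> app2 f xy z s -> app2 f x yz s;
  cml_comm : forall x y s : V, app2 f x y s -> app2 f y x s;
  cml_unit : forall x : V, x ∈ R -> app2 f x u x
}.

Definition upper_bound {V : set_structure} (le R A b : V) : Prop :=
  b ∈ R /\ forall x : V, x ∈ A -> app le x b.

(** [R] with the operations [add], [mul] and the order [le] (a set of ordered
    pairs) is, inside [V], a Dedekind-complete ordered field. *)
Record complete_ordered_field {V : set_structure}
    (R add mul le zero one : V) : Prop := {
  cof_zero_in : zero ∈ R;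
  cof_one_in : one ∈ R;
  cof_one_neq_zero : one <> zero;
  cof_add_op : is_binop add R;
  cof_mul_op : is_binop mul R;
  cof_add : comm_monoid_law R add zero;
  cof_opp : forall x : V, x ∈ R -> exists y : V, app2 add x y zero;
  cof_mul : comm_monoid_law R mul one;
  cof_inv : forall x : V, x ∈ R -> x <> zero ->
    exists y : V, app2 mul x y one;
  cof_distr : forall x y z yz xy xz s : V,
    app2 add y z yz -> app2 mul x yz s ->
    app2 mul x y xy -> app2 mul x z xz -> app2 add xy xz s;
  cof_le_total : forall x y : V, x ∈ R -> y ∈ R -> app le x y \/ app le y x;
  cof_le_antisym : forall x y : V, x ∈ R -> y ∈ R ->
    app le x y -> app le y x -> x = y;
  cof_le_trans : forall x y z : V, x ∈ R -> y ∈ R -> z ∈ R ->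
    app le x y -> app le y z -> app le x z;
  cof_le_add : forall x y z xz yz : V, x ∈ R -> y ∈ R -> z ∈ R ->
    app le x y -> app2 add x z xz -> app2 add y z yz -> app le xz yz;
  cof_le_mul : forall x y xy : V, x ∈ R -> y ∈ R ->
    app le zero x -> app le zero y -> app2 mul x y xy -> app le zero xy;
  cof_sup : forall A : V, subset A R ->
    (exists x : V, x ∈ A) -> (exists b : V, upper_bound le R A b) ->
    exists s : V, upper_bound le R A s /\
      forall b : V, upper_bound le R A b -> app le s b
}.

(** ZF proves that a complete ordered field exists and is unique up to
    isomorphism, so no particular construction of the real line is singled
    out. *)
Definition is_reals {V : set_structure} (R : V) : Prop :=
  exists add mul le zero one : V,
    complete_ordered_field R add mul le zero one.

(** * The hypergraph of rectangles *)

Definition two_element {V : set_structure} (a : V) : Prop :=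
  exists x y : V, x <> y /\ is_upair a x y.

Definition Gamma {V : set_structure} (R e : V) : Prop :=
  exists a b : V,
    subset a R /\ two_element a /\ subset b R /\ two_element b /\
    is_prod e a b.

Definition monochromatic {V : set_structure} (c e : V) : Prop :=
  exists n : V, forall p : V, p ∈ e -> app c p n.

(** The hypergraph with vertex set [X] and set of hyperedges [G]. *)
Definition countable_chromatic_number {V : set_structure}
    (X : V) (G : V -> Prop) : Prop :=
  exists w c : V, is_omega w /\ is_fun c X w /\
    forall e : V, G e -> ~ monochromatic c e.

Definition Gamma_countably_chromatic {V : set_structure} (R : V) : Prop :=
  exists R2 : V, is_prod R2 R R /\ countable_chromatic_number R2 (Gamma R).

(** * Sequences of reals and the relation E_1 *)

(** [s] is a sequence of length omega_1 of pairwise distinct elements of [R]. *)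
Definition omega1_injection {V : set_structure} (s R : V) : Prop :=
  exists o : V, is_omega1 o /\ is_fun s o R /\ injective s.

Definition is_seq {V : set_structure} (R x : V) : Prop :=
  exists w : V, is_omega w /\ is_fun x w R.

Definition E1 {V : set_structure} (R x y : V) : Prop :=
  is_seq R x /\ is_seq R y /\
  exists D : V,
    (forall n : V, n ∈ D <->
       exists a b : V, app x n a /\ app y n b /\ a <> b) /\
    finite D.

(** [I] below is the intersection of [S] with the E_1-class of [x]. *)
Definition complete_countable_section {V : set_structure} (R S : V) : Prop :=
  (forall x : V, x ∈ S -> is_seq R x) /\
  (forall x : V, is_seq R x ->
     exists I : V, (forall y : V, y ∈ I <-> y ∈ S /\ E1 R x y) /\
       (exists y : V, y ∈ I) /\ countable I).

(* Main.v *)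
From Stdlib Require Import ClassicalEpsilon FunctionalExtensionality PropExtensionality Classical PeanoNat Ring.
Require Import Defs.

(** Let [c] be a colouring of the plane without monochromatic rectangles. A real [x] is determined
    by two distinct reals [y], [y'] with [c(x, y) = c(x, y')], together with this colour.

    (1) Along an omega_1-sequence [s] the map [b -> c(x, s b)] is not injective, so [x] is determined
    by the first [b] at which it repeats a value, the earlier index and the colour. Only countably
    many keys lie below a given [b], so enumerating the reals by least key takes omega_1 steps.

    (2) If an omega_1-sequence of reals exists then, by (1) and since sequences of reals are coded by
    reals, every E_1-class has a least element. Otherwise attach to [t] a transfinite sequence of
    reals: its [a]-th term codes the well-orders of type [a] on subsets of omega obtained from
    [b -> c(u, t'_b)], [b < a], for those modifications [u], [t'] of [t] on initial segments
    for which the terms [t'_b] exist and this map is injective; it is undefined if there are none.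
    Its length [rho t] is a countable ordinal and does not grow when an initial segment of [t] is
    erased to [t']; if [rho t' = rho t] then [b -> c(t, t'_b)] is not injective, which determines [t]
    from [t'], two ordinals below [rho t] and a colour. Hence each class has only countably many
    elements of minimal [rho].

    Subsets of the structure are obtained from first-order Separation and Replacement only, so each
    class and operation used comes with a proof of definability ([def], [dt]), found by [defn]. *)

Existing Class ZF.

(** * Definable classes and definable operations *)

Definition up (f : nat -> nat) (n : nat) : nat :=
  match n with O => O | S m => S (f m) end.

Fixpoint ren (f : nat -> nat) (phi : formula) : formula :=
  match phi with
  | Mem i j => Mem (f i) (f j)
  | Equ i j => Equ (f i) (f j)
  | Bot => Bot
  | Imp p q => Imp (ren f p) (ren f q)
  | And p q => And (ren f p) (ren f q)
  | Or p q => Or (ren f p) (ren f q)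
  | All p => All (ren (up f) p)
  | Ex p => Ex (ren (up f) p)
  end.

Lemma scons_up {T : Type} (x : T) (e : nat -> T) f :
  (fun i => scons x e (up f i)) = scons x (fun i => e (f i)).
Proof. apply functional_extensionality. now intros [|i]. Qed.

(** Moving variables inside a formula amounts to reading the environment through [f]; a binder keeps
    its own index 0, whence [up]. *)
Lemma sat_ren {V : set_structure} (phi : formula) : forall f (e : nat -> V),
  sat e (ren f phi) <-> sat (fun i => e (f i)) phi.
Proof.
  induction phi as [i j|i j| |p IHp q IHq|p IHp q IHq|p IHp q IHq|p IHp|p IHp];
    intros f e; simpl; try (rewrite ?IHp, ?IHq; tauto).
  - split; intros H x; specialize (H x); rewrite IHp, scons_up in *; exact H.
  - split; intros [x H]; exists x; rewrite IHp, scons_up in *; exact H.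
Qed.

Section Definability.
Context {V : set_structure}.

(** Tuples grow on the right, so the last component is the most recently bound variable, that is,
    index 0. *)
Fixpoint env (n : nat) : Type :=
  match n with O => unit | S m => (env m * V)%type end.

Fixpoint push {n : nat} : env n -> (nat -> V) -> nat -> V :=
  match n with
  | O => fun _ e => e
  | S m => fun g e => scons (snd g) (push (fst g) e)
  end.

Definition hd {n : nat} (g : env (S n)) : V := snd g.
Definition tl {n : nat} (g : env (S n)) : env n := fst g.

(** Index [i < n] of [phi] is a component of [g]; the other indices are parameters. *)
Definition def {n : nat} (P : env n -> Prop) : Prop :=
  exists phi e, forall g, P g <-> sat (push g e) phi.

(** The language has no function symbols, so an operation counts as definable when its graph is. *)
Definition dt {n : nat} (f : env n -> V) : Prop :=
  def (fun g : env (S n) => hd g = f (tl g)).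

(** [s] selects variables, and [r] is the corresponding renaming. *)
Definition dts {m n : nat} (s : env m -> env n) : Prop :=
  exists r, forall g e i, push (s g) e i = push g e (r i).

Lemma dts_id n : dts (fun g : env n => g).
Proof. now exists (fun i => i). Qed.

Lemma dts_tl m n (s : env m -> env (S n)) : dts s -> dts (fun g => tl (s g)).
Proof.
  intros [r H]. exists (fun i => r (S i)). intros g e i. now rewrite <- H.
Qed.

Lemma dts_lift m n (s : env m -> env n) : dts s ->
  dts (fun g : env (S m) => ((s (tl g), hd g) : env (S n))).
Proof.
  intros [r H]. exists (up r). intros g e [|i]; [reflexivity|]. simpl. apply H.
Qed.

Lemma def_iff_def n (P Q : env n -> Prop) :
  (forall g, P g <-> Q g) -> def Q -> def P.
Proof.
  intros H [phi [e E]]. exists phi, e. intros g. now rewrite H, E.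
Qed.

Lemma def_subst m n (s : env m -> env n) (P : env n -> Prop) :
  dts s -> def P -> def (fun g => P (s g)).
Proof.
  intros [r Hr] [phi [e E]]. exists (ren r phi), e. intros g.
  rewrite E, sat_ren.
  replace (fun i => push g e (r i)) with (push (s g) e); [reflexivity|].
  apply functional_extensionality. intros i. apply Hr.
Qed.

Fixpoint lift (n : nat) (f : nat -> nat) : nat -> nat :=
  match n with O => f | S m => up (lift m f) end.

Lemma push_lift n (g : env n) e e' f : (forall i, e' (f i) = e i) ->
  forall i, push g e' (lift n f i) = push g e i.
Proof.
  intros H. induction n as [|n IH]; [exact H|]. intros [|i]; [reflexivity|].
  apply IH.
Qed.

(** Lifting [f] past the [n] variables moves only the parameters, so a formula can be read with any
    parameter list that contains its own. *)
Lemma def_params n (P : env n -> Prop) phi e e' f :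
  (forall i, e' (f i) = e i) -> (forall g, P g <-> sat (push g e) phi) ->
  forall g, P g <-> sat (push g e') (ren (lift n f) phi).
Proof.
  intros H E g. rewrite E, sat_ren.
  replace (fun i => push g e' (lift n f i)) with (push g e); [reflexivity|].
  apply functional_extensionality. intros i. symmetry. now apply push_lift.
Qed.

(** Even positions hold one parameter list and odd positions the other, so that formulas with
    different parameters can be joined by a connective. *)
Definition merge (e e' : nat -> V) (i : nat) : V :=
  if Nat.even i then e (Nat.div2 i) else e' (Nat.div2 i).

Lemma def_common n (P Q : env n -> Prop) : def P -> def Q ->
  exists phi psi e, (forall g, P g <-> sat (push g e) phi) /\
                    (forall g, Q g <-> sat (push g e) psi).
Proof.
  intros [phi [e E]] [psi [e' E']].
  exists (ren (lift n (fun i => 2 * i)) phi),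
         (ren (lift n (fun i => S (2 * i))) psi), (merge e e').
  split.
  - apply (def_params n P phi e); [|exact E]. intros i. unfold merge.
    now rewrite Nat.even_even, Nat.div2_double.
  - apply (def_params n Q psi e'); [|exact E']. intros i. unfold merge.
    rewrite Nat.even_succ, Nat.odd_even, Nat.div2_succ_double. reflexivity.
Qed.

Lemma def_and n (P Q : env n -> Prop) : def P -> def Q ->
  def (fun g => P g /\ Q g).
Proof.
  intros HP HQ. destruct (def_common n P Q HP HQ) as [p [q [e [Hp Hq]]]].
  exists (And p q), e. intros g. simpl. now rewrite Hp, Hq.
Qed.

Lemma def_or n (P Q : env n -> Prop) : def P -> def Q ->
  def (fun g => P g \/ Q g).
Proof.
  intros HP HQ. destruct (def_common n P Q HP HQ) as [p [q [e [Hp Hq]]]].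
  exists (Or p q), e. intros g. simpl. now rewrite Hp, Hq.
Qed.

Lemma def_imp n (P Q : env n -> Prop) : def P -> def Q ->
  def (fun g => P g -> Q g).
Proof.
  intros HP HQ. destruct (def_common n P Q HP HQ) as [p [q [e [Hp Hq]]]].
  exists (Imp p q), e. intros g. simpl. now rewrite Hp, Hq.
Qed.

Lemma def_ex n (P : env n -> V -> Prop) :
  def (fun g : env (S n) => P (tl g) (hd g)) ->
  def (fun g => exists x, P g x).
Proof.
  intros [p [e H]]. exists (Ex p), e. intros g. simpl.
  split; intros [x Hx]; exists x; apply (H (g, x)); exact Hx.
Qed.

Lemma def_all n (P : env n -> V -> Prop) :
  def (fun g : env (S n) => P (tl g) (hd g)) ->
  def (fun g => forall x, P g x).
Proof.
  intros [p [e H]]. exists (All p), e. intros g. simpl.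
  split; intros Hx x; apply (H (g, x)); apply Hx.
Qed.

Context {hV : ZF V}.

Lemma V_inhabited : inhabited V.
Proof. destruct (ZF_infinity V hV) as [I _]. exact (inhabits I). Qed.

(** A proposition independent of the variables is true or false, so one of two trivial formulas
    defines it. *)
Lemma def_const n (P : Prop) : def (fun _ : env n => P).
Proof.
  destruct V_inhabited as [v].
  destruct (classic P) as [H|H]; [exists (Imp Bot Bot)|exists Bot];
    exists (fun _ => v); simpl; tauto.
Qed.

Lemma def_not n (P : env n -> Prop) : def P -> def (fun g => ~ P g).
Proof. intros H. apply def_imp; [exact H|apply def_const]. Qed.

Lemma def_iff n (P Q : env n -> Prop) : def P -> def Q ->
  def (fun g => P g <-> Q g).
Proof. intros. apply def_and; apply def_imp; assumption. Qed.

Lemma dt_var m n (s : env m -> env (S n)) : dts s -> dt (fun g => hd (s g)).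
Proof.
  intros [r H]. destruct V_inhabited as [v].
  exists (Equ 0 (S (r 0))), (fun _ => v). intros [g x]. simpl.
  rewrite <- H. reflexivity.
Qed.

Lemma dt_const n (a : V) : dt (fun _ : env n => a).
Proof.
  exists (Equ 0 (S n)), (fun _ => a). intros [g x]. simpl.
  replace (push g (fun _ : nat => a) n) with a; [reflexivity|].
  clear x. induction n as [|n IH]; [reflexivity|apply IH].
Qed.

(** Substitution of a definable term is expressed by a quantifier: some [y] equal to the term
    satisfies [P]. *)
Lemma def_inst m n (P : env n -> V -> Prop) (s : env m -> env n) t :
  def (fun g : env (S n) => P (tl g) (hd g)) -> dts s -> dt t ->
  def (fun g => P (s g) (t g)).
Proof.
  intros HP Hs Ht.
  apply (def_iff_def _ _ (fun g => exists y, y = t g /\ P (s g) y)).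
  { intros g. split; [eauto|]. now intros [y [-> H]]. }
  apply def_ex, def_and; [exact Ht|].
  exact (def_subst _ _ _ _ (dts_lift _ _ s Hs) HP).
Qed.

Lemma dt_weak m n (s : env m -> env n) f :
  dt f -> dts s -> dt (fun g => f (s g)).
Proof.
  intros Hf Hs. exact (def_subst _ _ _ _ (dts_lift _ _ s Hs) Hf).
Qed.

Lemma def_inst2 m n (P : env n -> V -> V -> Prop) (s : env m -> env n) t u :
  def (fun g : env (S (S n)) => P (tl (tl g)) (hd (tl g)) (hd g)) ->
  dts s -> dt t -> dt u ->
  def (fun g => P (s g) (t g) (u g)).
Proof.
  intros HP Hs Ht Hu.
  apply (def_inst m m (fun g x => P (s g) x (u g)) (fun g => g)); auto using dts_id.
  apply (def_inst (S m) (S n) (fun g y => P (tl g) (hd g) y)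
     (fun g => ((s (tl g), hd g) : env (S n)))); auto using dts_lift.
  apply (dt_weak (S m) m (fun g => tl g) u Hu), dts_tl, dts_id.
Qed.

Lemma dt_inst m n (f : env n -> V -> V) (s : env m -> env n) t :
  dt (fun g : env (S n) => f (tl g) (hd g)) -> dts s -> dt t ->
  dt (fun g => f (s g) (t g)).
Proof.
  intros Hf Hs Ht.
  apply (def_inst2 (S m) n (fun g x y => y = f g x)
    (fun g => s (tl g)) (fun g => t (tl g)) (fun g => hd g)).
  - exact Hf.
  - exact (dts_tl _ _ _ (dts_lift _ _ _ Hs)).
  - apply (dt_weak (S m) m (fun g => tl g) t Ht), dts_tl, dts_id.
  - apply dt_var, dts_id.
Qed.

Lemma dt_inst2 m n (f : env n -> V -> V -> V) (s : env m -> env n) t u :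
  dt (fun g : env (S (S n)) => f (tl (tl g)) (hd (tl g)) (hd g)) ->
  dts s -> dt t -> dt u ->
  dt (fun g => f (s g) (t g) (u g)).
Proof.
  intros Hf Hs Ht Hu.
  apply (dt_inst m m (fun g x => f (s g) x (u g)) (fun g => g)); auto using dts_id.
  apply (dt_inst (S m) (S n) (fun g y => f (tl g) (hd g) y)
     (fun g => ((s (tl g), hd g) : env (S n)))); auto using dts_lift.
  apply (dt_weak (S m) m (fun g => tl g) u Hu), dts_tl, dts_id.
Qed.

Lemma def_eq n (f h : env n -> V) : dt f -> dt h -> def (fun g => f g = h g).
Proof.
  intros Hf Hh.
  exact (def_inst n n (fun g y => y = h g) (fun g => g) f Hh (dts_id _) Hf).
Qed.

Lemma def_mem n (f h : env n -> V) : dt f -> dt h -> def (fun g => f g ∈ h g).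
Proof.
  intros Hf Hh. destruct V_inhabited as [v].
  apply (def_inst2 n n (fun _ x y => x ∈ y) (fun g => g)); trivial using dts_id.
  exists (Mem 1 0), (fun _ => v). intros g. reflexivity.
Qed.

(** * Definite descriptions *)

(** The junk value, when there is no unique witness, is the empty set. *)
Definition the_spec (P : V -> Prop) (y : V) : Prop :=
  (P y /\ forall z, P z -> z = y) \/
  (~ (exists y, P y /\ forall z, P z -> z = y) /\ is_empty y).

(** The ambient choice operator brings no choice into [V]: [the_spec] has exactly one solution, so
    the value is determined by [P]. *)
Definition the (P : V -> Prop) : V := epsilon V_inhabited (the_spec P).

Lemma ext (x y : V) : (forall z, z ∈ x <-> z ∈ y) -> x = y.
Proof. apply (ZF_extensionality V hV). Qed.

Lemma the_spec_unique P y y' : the_spec P y -> the_spec P y' -> y = y'.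
Proof.
  intros [[H1 H2]|[H1 H2]] [[H1' H2']|[H1' H2']]; auto.
  - destruct H1'; eauto.
  - destruct H1; eauto.
  - apply ext. intros z. split; intros Hz; [destruct (H2 z Hz)|destruct (H2' z Hz)].
Qed.

Lemma empty_ex : exists x : V, is_empty x.
Proof. destruct (ZF_infinity V hV) as [I [[z [H _]] _]]. now exists z. Qed.

Lemma the_specP P : the_spec P (the P).
Proof.
  unfold the. apply epsilon_spec. unfold the_spec.
  destruct (classic (exists y, P y /\ forall z, P z -> z = y)) as [[y H]|H].
  - exists y. tauto.
  - destruct empty_ex as [x Hx]. exists x. tauto.
Qed.

Lemma the_eq (P : V -> Prop) y : P y -> (forall z, P z -> z = y) -> the P = y.
Proof.
  intros H1 H2. apply (the_spec_unique P); [apply the_specP|]. left. tauto.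
Qed.

Lemma theP (P : V -> Prop) :
  (exists y, P y) -> (forall y z, P y -> P z -> y = z) -> P (the P).
Proof.
  intros [y Hy] H. rewrite (the_eq P y); trivial. intros z Hz. now apply H.
Qed.

(** The graph of the description is [the_spec], a first-order combination of [P] and emptiness. *)
Lemma dt_the n (P : env n -> V -> Prop) :
  def (fun g : env (S n) => P (tl g) (hd g)) -> dt (fun g => the (P g)).
Proof.
  intros H. unfold dt.
  apply (def_iff_def (S n) _ (fun g => the_spec (P (tl g)) (hd g))).
  { intros g. split; [intros ->; apply the_specP|].
    intros Hg. apply (the_spec_unique _ _ _ Hg), the_specP. }
  unfold the_spec.
  assert (D : forall m (s : env m -> env n), dts s ->
     def (fun g : env (S m) => P (s (tl g)) (hd g) /\
        forall z, P (s (tl g)) z -> z = hd g)).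
  { intros m s Hs. apply def_and.
    - apply (def_inst (S m) n P (fun g : env (S m) => s (tl g)) (fun g : env (S m) => hd g) H).
      + exact (dts_tl _ _ _ (dts_lift _ _ _ Hs)).
      + apply dt_var, dts_id.
    - apply def_all, def_imp.
      + apply (def_inst (S (S m)) n P (fun g : env (S (S m)) => s (tl (tl g)))
          (fun g : env (S (S m)) => hd g) H).
        * exact (dts_tl _ _ _ (dts_tl _ _ _ (dts_lift _ _ _ (dts_lift _ _ _ Hs)))).
        * apply dt_var, dts_id.
      + apply def_eq; [apply dt_var, dts_id|apply dt_var, dts_tl, dts_id]. }
  apply def_or; [apply (D n (fun g => g)), dts_id|].
  apply def_and.
  - apply def_not, def_ex. apply (D (S n) (fun g : env (S n) => tl g)), dts_tl, dts_id.
  - apply def_all, def_not, def_mem; [apply dt_var, dts_id|apply dt_var, dts_tl, dts_id].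
Qed.

End Definability.
Arguments env V n : clear implicits.

(* Automatic proofs of definability *)
Create HintDb defdb.
#[export] Hint Resolve dts_id dts_tl dt_var dt_the def_and def_or def_imp def_ex def_all
  def_not def_iff def_eq def_mem : defdb.
#[export] Hint Resolve dt_const def_const | 50 : defdb.

#[export] Hint Extern 3 (dt _) => match goal with
  | H : dt ?f |- _ => is_var f; refine (dt_weak _ _ _ _ H _) end : defdb.
#[export] Hint Extern 3 (dt _) => match goal with
  | H : @dt _ (S _) _ |- _ => refine (dt_inst _ _ _ _ _ H _ _) end : defdb.
#[export] Hint Extern 3 (dt _) => match goal with
  | H : @dt _ (S (S _)) _ |- _ => refine (dt_inst2 _ _ _ _ _ _ H _ _ _) end : defdb.
#[export] Hint Extern 3 (def _) => match goal with
  | H : @def _ (S _) _ |- _ => refine (def_inst _ _ _ _ _ H _ _) end : defdb.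
#[export] Hint Extern 3 (def _) => match goal with
  | H : @def _ (S (S _)) _ |- _ => refine (def_inst2 _ _ _ _ _ _ H _ _ _) end : defdb.
Ltac defn := solve [auto 300 with defdb nocore].
Ltac defu f := intros; unfold f; defn.
#[global] Opaque the.

(** * Set-theoretic operations as definable terms *)

Section Sets.
Context {V : set_structure} {hV : ZF V}.
Implicit Types x y z a b f : V.

Definition cls (P : V -> Prop) : Prop := def (fun g : env V 1 => P (hd g)).
Definition op (F : V -> V) : Prop := dt (fun g : env V 1 => F (hd g)).

Lemma dts_hd n : dts (fun g : env V (S n) => ((tt, hd g) : env V 1)).
Proof.
  exists (fun i => match i with O => O | S i => S (n + i) end). intros g e [|i]; trivial.
  destruct g as [g x]. simpl. induction n as [|n IH]; [reflexivity|]. apply IH.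
Qed.

Lemma dt_op n F (t : env V n -> V) : op F -> dt t -> dt (fun g => F (t g)).
Proof.
  intros HF Ht. apply (dt_inst n n (fun _ y => F y) (fun g => g)); auto using dts_id.
  exact (dt_weak (S n) 1 _ _ HF (dts_hd n)).
Qed.

Lemma def_cls n P (t : env V n -> V) : cls P -> dt t -> def (fun g => P (t g)).
Proof.
  intros HP Ht. apply (def_inst n n (fun _ y => P y) (fun g => g)); auto using dts_id.
  exact (def_subst (S n) 1 _ _ (dts_hd n) HP).
Qed.

#[local] Hint Extern 3 (dt _) => match goal with
  | H : op _ |- _ => refine (dt_op _ _ _ H _) end : defdb.
#[local] Hint Extern 3 (def _) => match goal with
  | H : cls _ |- _ => refine (def_cls _ _ _ H _) end : defdb.
#[local] Hint Extern 1 (op _) => unfold op; cbv beta : defdb.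
#[local] Hint Extern 1 (cls _) => unfold cls; cbv beta : defdb.

Definition upair x y : V := the (fun a => is_upair a x y).
Definition opair x y : V := upair (upair x x) (upair x y).
Definition Un a : V := the (fun u => forall x, x ∈ u <-> exists y, y ∈ a /\ x ∈ y).
Definition Pw a : V := the (fun p => forall x, x ∈ p <-> subset x a).
Definition sep a (P : V -> Prop) : V :=
  the (fun b => forall x, x ∈ b <-> x ∈ a /\ P x).
Definition repl a (F : V -> V) : V :=
  the (fun b => forall y, y ∈ b <-> exists x, x ∈ a /\ y = F x).
Definition emp : V := the is_empty.
Definition setU a b : V := Un (upair a b).
Definition succ x : V := setU x (upair x x).
Definition lam a (F : V -> V) : V := repl a (fun x => opair x (F x)).
Definition ap f x : V := the (fun y => opair x y ∈ f).
Definition om : V := the is_omega.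
Definition prod a b : V := the (fun P => is_prod P a b).

(** Extensionality makes a set described by its members unique, so a description is justified as
    soon as existence is known. *)
Lemma the_set (Q : V -> Prop) (P : V -> Prop) :
  (forall x, Q x <-> (forall z, z ∈ x <-> P z)) -> (exists x, forall z, z ∈ x <-> P z) ->
  forall z, z ∈ the Q <-> P z.
Proof.
  intros H [x Hx]. apply H. apply theP; [exists x; now apply H|].
  intros y z Hy Hz. apply ext. intros w.
  rewrite (proj1 (H y) Hy), (proj1 (H z) Hz). tauto.
Qed.

Lemma mem_upair x y z : z ∈ upair x y <-> z = x \/ z = y.
Proof.
  apply (the_set _ (fun z => z = x \/ z = y)); [reflexivity|].
  apply (ZF_pairing V hV x y).
Qed.

Lemma mem_Un a x : x ∈ Un a <-> exists y, y ∈ a /\ x ∈ y.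
Proof.
  apply (the_set _ (fun x => exists y, y ∈ a /\ x ∈ y)); [reflexivity|].
  apply (ZF_union V hV a).
Qed.

Lemma mem_Pw a x : x ∈ Pw a <-> subset x a.
Proof.
  apply (the_set _ (fun x => subset x a)); [reflexivity|].
  apply (ZF_power_set V hV a).
Qed.

Lemma mem_sep a P x : cls P -> x ∈ sep a P <-> x ∈ a /\ P x.
Proof.
  intros [phi [e H]].
  apply (the_set _ (fun x => x ∈ a /\ P x)); [reflexivity|].
  destruct (ZF_separation V hV phi e a) as [b Hb]. exists b. intros z.
  rewrite Hb. specialize (H (tt, z)). simpl in H. unfold hd in H. simpl in H.
  now rewrite H.
Qed.

Lemma mem_repl a F y : op F -> y ∈ repl a F <-> exists x, x ∈ a /\ y = F x.
Proof.
  intros HF.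
  apply (the_set _ (fun y => exists x, x ∈ a /\ y = F x)); [reflexivity|].
  assert (H : def (fun g : env V 2 => hd (tl g) = F (hd g))) by defn.
  destruct H as [phi [e H]].
  assert (E : forall x y, sat (scons x (scons y e)) phi <-> y = F x).
  { intros x z. specialize (H (tt, z, x)). simpl in H. unfold hd, tl in H. simpl in H.
    now rewrite H. }
  destruct (ZF_replacement V hV phi e a) as [b Hb].
  { intros x _. exists (F x). split; [now apply E|]. intros z Hz. now apply E in Hz. }
  exists b. intros z. rewrite Hb.
  split; intros [x [Hx Hz]]; exists x; split; trivial; now apply E.
Qed.

Lemma mem_emp x : x ∉ emp.
Proof.
  apply (theP is_empty); [apply empty_ex|].
  intros y z Hy Hz. apply ext. intros w. split; intros Hw; [destruct (Hy w Hw)|destruct (Hz w Hw)].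
Qed.

Lemma eq_emp a : is_empty a -> a = emp.
Proof.
  intros H. apply ext. intros z. split; intros Hz; [destruct (H z Hz)|destruct (mem_emp z Hz)].
Qed.

Lemma mem_setU a b x : x ∈ setU a b <-> x ∈ a \/ x ∈ b.
Proof.
  unfold setU. rewrite mem_Un. split.
  - intros [y [Hy Hx]]. apply mem_upair in Hy. destruct Hy as [->| ->]; tauto.
  - intros [H|H]; [exists a|exists b]; rewrite mem_upair; tauto.
Qed.

Lemma mem_succ x z : z ∈ succ x <-> z ∈ x \/ z = x.
Proof. unfold succ. rewrite mem_setU, mem_upair. tauto. Qed.

Lemma is_succP s x : is_succ s x <-> s = succ x.
Proof.
  split.
  - intros H. apply ext. intros z. now rewrite (H z), mem_succ.
  - intros -> z. apply mem_succ.
Qed.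

Lemma is_upairP a x y : is_upair a x y <-> a = upair x y.
Proof.
  split.
  - intros H. apply ext. intros z. now rewrite (H z), mem_upair.
  - intros -> z. apply mem_upair.
Qed.

Lemma is_opairP p x y : is_opair p x y <-> p = opair x y.
Proof.
  unfold is_opair, opair. split.
  - intros [a [b [Ha [Hb Hp]]]]. apply is_upairP in Ha, Hb, Hp. congruence.
  - intros ->. exists (upair x x), (upair x y). now rewrite !is_upairP.
Qed.

Lemma opair_inj x y x' y' : opair x y = opair x' y' -> x = x' /\ y = y'.
Proof.
  unfold opair. intros H.
  assert (U : forall a b c d, upair a b = upair c d -> (a = c \/ a = d) /\ (b = c \/ b = d)
     /\ (c = a \/ c = b) /\ (d = a \/ d = b)).
  { intros a b c d E. rewrite <- !mem_upair.
    repeat split; [rewrite <- E|rewrite <- E|rewrite E|rewrite E]; apply mem_upair; auto. }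
  assert (X : x = x').
  { apply U in H. destruct H as [[H|H] _]; apply U in H; intuition congruence. }
  subst x'. split; trivial. apply U in H.
  destruct H as [_ [[H|H] [_ [K|K]]]]; apply U in H; apply U in K; intuition congruence.
Qed.

Lemma mem_lam a F p : op F -> p ∈ lam a F <-> exists x, x ∈ a /\ p = opair x (F x).
Proof.
  intros HF. apply mem_repl. unfold opair, upair, is_upair. defn.
Qed.

Lemma appE f x y : app f x y <-> opair x y ∈ f.
Proof.
  unfold app. split.
  - intros [p [Hp H]]. apply is_opairP in Hp. now subst.
  - intros H. exists (opair x y). now rewrite is_opairP.
Qed.

(** Only the values on [a] enter the describing condition, so the two describing predicates
    coincide. *)
Lemma lam_ext a F F' : (forall x, x ∈ a -> F x = F' x) -> lam a F = lam a F'.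
Proof.
  intros E. unfold lam, repl. f_equal. apply functional_extensionality. intros b.
  apply propositional_extensionality.
  split; intros H y; rewrite (H y); split; intros [x [Hx ->]]; exists x;
  (split; [trivial|]); rewrite E; trivial.
Qed.

Lemma app_lam a F x y : op F -> app (lam a F) x y <-> x ∈ a /\ y = F x.
Proof.
  intros HF. rewrite appE, mem_lam by trivial. split.
  - intros [x' [Hx E]]. apply opair_inj in E. destruct E as [-> ->]. tauto.
  - intros [Hx ->]. now exists x.
Qed.

Lemma ap_eq f x y : app f x y -> (forall z, app f x z -> z = y) -> ap f x = y.
Proof.
  intros H1 H2. apply the_eq; [now apply appE|]. intros z Hz. now apply H2, appE.
Qed.

Lemma ap_lam a F x : op F -> x ∈ a -> ap (lam a F) x = F x.
Proof.
  intros HF Hx. apply ap_eq; [apply app_lam; auto|]. intros z Hz. apply app_lam in Hz; tauto.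
Qed.

Lemma is_fun_lam a b F : op F -> (forall x, x ∈ a -> F x ∈ b) -> is_fun (lam a F) a b.
Proof.
  intros HF H. split.
  - intros p Hp. apply mem_lam in Hp; trivial. destruct Hp as [x [Hx ->]].
    exists x, (F x). rewrite is_opairP. auto.
  - intros x Hx. exists (F x). split; [apply app_lam; auto|].
    intros z Hz. apply app_lam in Hz; [symmetry|]; tauto.
Qed.

Lemma app_fun f a b x y : is_fun f a b -> app f x y <-> x ∈ a /\ y = ap f x.
Proof.
  intros [H1 H2].
  assert (K : forall y, app f x y -> x ∈ a).
  { intros z Hz. apply appE in Hz. destruct (H1 _ Hz) as [x' [y' [Hx [_ E]]]].
    apply is_opairP, opair_inj in E. now destruct E as [-> _]. }
  assert (L : forall y, app f x y -> ap f x = y).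
  { intros z Hz. apply ap_eq; trivial. intros w Hw.
    destruct (H2 x (K _ Hz)) as [v [_ Hv]]. now rewrite <- (Hv z), <- (Hv w). }
  split.
  - intros H. split; [eauto|]. symmetry. auto.
  - intros [Hx ->]. destruct (H2 x Hx) as [v [Hv _]]. now rewrite (L v).
Qed.

Lemma fun_in f a b x : is_fun f a b -> x ∈ a -> ap f x ∈ b.
Proof.
  intros H Hx. assert (K : app f x (ap f x)) by now apply (app_fun f a b).
  apply appE in K. destruct H as [H _]. destruct (H _ K) as [x' [y' [_ [Hy E]]]].
  apply is_opairP, opair_inj in E. now destruct E as [_ ->].
Qed.

Lemma fun_ext f f' a b b' : is_fun f a b -> is_fun f' a b' ->
  (forall x, x ∈ a -> ap f x = ap f' x) -> f = f'.
Proof.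
  assert (K : forall f f' b b', is_fun f a b -> is_fun f' a b' ->
    (forall x, x ∈ a -> ap f x = ap f' x) -> subset f f').
  { intros k k' c c' H H' E p Hp. destruct (proj1 H p Hp) as [x [y [Hx [Hy Ep]]]].
    apply is_opairP in Ep. subst p. apply appE in Hp. apply appE.
    apply (app_fun k a c) in Hp; trivial. apply (app_fun k' a c'); trivial.
    rewrite <- E; tauto. }
  intros H H' E. apply ext. intros z.
  split; [apply (K f f' b b')|apply (K f' f b' b)]; auto.
  intros x Hx. symmetry. auto.
Qed.

Lemma injectiveP f a b : is_fun f a b ->
  (injective f <-> forall x x', x ∈ a -> x' ∈ a -> ap f x = ap f x' -> x = x').
Proof.
  intros H. unfold injective. split.
  - intros K x x' Hx Hx' E. apply (K x x' (ap f x)); apply (app_fun f a b); auto.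
  - intros K x x' y E E'. apply (app_fun f a b) in E; trivial.
    apply (app_fun f a b) in E'; trivial. apply K; intuition congruence.
Qed.

Lemma mem_prod a b p : p ∈ prod a b <-> exists x y, x ∈ a /\ y ∈ b /\ p = opair x y.
Proof.
  assert (X : forall P, is_prod P a b <-> forall p, p ∈ P <-> exists x y, x ∈ a /\ y ∈ b /\ p = opair x y).
  { intros P. unfold is_prod. split; intros H q; rewrite (H q);
    split; intros [x [y [? [? E]]]]; exists x, y; rewrite is_opairP in *; auto. }
  apply (the_set _ (fun p => exists x y, x ∈ a /\ y ∈ b /\ p = opair x y)); [exact X|].
  (* A Kuratowski pair of elements of [a] and [b] is a set of subsets of their union, so Separation
     from the double power set suffices. *)
  exists (sep (Pw (Pw (setU a b))) (fun p => exists x y, x ∈ a /\ y ∈ b /\ p = opair x y)).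
  intros z. rewrite mem_sep.
  - split; [tauto|]. intros [x [y [Hx [Hy ->]]]]. split; [|now exists x, y].
    apply mem_Pw. intros w Hw. apply mem_Pw. intros v Hv. apply mem_setU.
    unfold opair in Hw. apply mem_upair in Hw. destruct Hw as [-> | ->];
    apply mem_upair in Hv; destruct Hv as [-> | ->]; auto.
  - unfold opair, upair, is_upair. defn.
Qed.

Lemma is_prodP P a b : is_prod P a b <-> P = prod a b.
Proof.
  assert (X : is_prod P a b <-> forall p, p ∈ P <-> exists x y, x ∈ a /\ y ∈ b /\ p = opair x y).
  { unfold is_prod. split; intros H q; rewrite (H q);
    split; intros [x [y [? [? E]]]]; exists x, y; rewrite is_opairP in *; auto. }
  rewrite X. split.
  - intros H. apply ext. intros p. now rewrite H, mem_prod.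
  - intros -> p. apply mem_prod.
Qed.

Lemma def_is_empty n (s : env V n -> V) : dt s -> def (fun g => is_empty (s g)).
Proof. defu @is_empty. Qed.
Lemma def_subset n (s t : env V n -> V) : dt s -> dt t -> def (fun g => subset (s g) (t g)).
Proof. defu @subset. Qed.
Lemma def_is_upair n (s t u : env V n -> V) : dt s -> dt t -> dt u -> def (fun g => is_upair (s g) (t g) (u g)).
Proof. defu @is_upair. Qed.
Lemma dt_upair n (s t : env V n -> V) : dt s -> dt t -> dt (fun g => upair (s g) (t g)).
Proof. unfold upair, is_upair. defn. Qed.
Hint Resolve def_is_empty def_subset def_is_upair dt_upair : defdb.
Lemma dt_opair n (s t : env V n -> V) : dt s -> dt t -> dt (fun g => opair (s g) (t g)).
Proof. defu opair. Qed.
Hint Resolve dt_opair : defdb.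
Lemma dt_Un n (s : env V n -> V) : dt s -> dt (fun g => Un (s g)).
Proof. defu Un. Qed.
Lemma dt_Pw n (s : env V n -> V) : dt s -> dt (fun g => Pw (s g)).
Proof. unfold Pw, subset. defn. Qed.
Lemma dt_sep n (s : env V n -> V) (P : env V n -> V -> Prop) : dt s ->
  def (fun g : env V (S n) => P (tl g) (hd g)) -> dt (fun g => sep (s g) (P g)).
Proof. defu sep. Qed.
Lemma dt_repl n (s : env V n -> V) (F : env V n -> V -> V) : dt s ->
  dt (fun g : env V (S n) => F (tl g) (hd g)) -> dt (fun g => repl (s g) (F g)).
Proof. defu repl. Qed.
Hint Resolve dt_Un dt_Pw dt_sep dt_repl : defdb.
Lemma dt_setU n (s t : env V n -> V) : dt s -> dt t -> dt (fun g => setU (s g) (t g)).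
Proof. defu setU. Qed.
Hint Resolve dt_setU : defdb.
Lemma dt_succ n (s : env V n -> V) : dt s -> dt (fun g => succ (s g)).
Proof. defu succ. Qed.
Lemma dt_ap n (s t : env V n -> V) : dt s -> dt t -> dt (fun g => ap (s g) (t g)).
Proof. defu ap. Qed.
End Sets.
#[export] Hint Resolve def_is_empty def_subset def_is_upair dt_upair dt_opair dt_Un dt_Pw dt_sep
  dt_repl dt_setU dt_succ dt_ap : defdb.

Lemma dt_lam {V : set_structure} {hV : ZF V} n (s : env V n -> V) (F : env V n -> V -> V) :
  dt s -> dt (fun g : env V (S n) => F (tl g) (hd g)) -> dt (fun g => lam (s g) (F g)).
Proof. defu @lam. Qed.
#[export] Hint Resolve dt_lam : defdb.
#[global] Opaque upair opair Un Pw sep repl emp setU succ ap prod.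
#[export] Hint Extern 3 (dt _) => match goal with
  | H : op _ |- _ => refine (dt_op _ _ _ H _) end : defdb.
#[export] Hint Extern 3 (def _) => match goal with
  | H : cls _ |- _ => refine (def_cls _ _ _ H _) end : defdb.
#[export] Hint Extern 1 (op _) => unfold op; cbv beta : defdb.
#[export] Hint Extern 1 (cls _) => unfold cls; cbv beta : defdb.

(** * Ordinals and natural numbers *)
Section Ordinals.
Context {V : set_structure} {hV : ZF V}.
Implicit Types x y z a b c f n m k : V.

Lemma foundation (P : V -> Prop) x : cls P -> (exists y, y ∈ x /\ P y) ->
  exists y, y ∈ x /\ P y /\ forall z, z ∈ x -> P z -> z ∉ y.
Proof.
  intros HP [y Hy].
  destruct (ZF_foundation V hV (sep x P)) as [z [Hz H]].
  { exists y. now apply mem_sep. }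
  apply mem_sep in Hz; trivial. exists z. split; [tauto|split; [tauto|]].
  intros w Hw Pw. apply H. now apply mem_sep.
Qed.

Lemma mem_irrefl x : x ∉ x.
Proof.
  intros H. destruct (foundation (fun _ => True) (upair x x)) as [y [Hy [_ K]]].
  - defn.
  - exists x. rewrite mem_upair. auto.
  - apply mem_upair in Hy. assert (y = x) as -> by tauto.
    apply (K x); trivial. apply mem_upair. auto.
Qed.

Lemma mem_asym x y : x ∈ y -> y ∉ x.
Proof.
  intros H H'. destruct (foundation (fun _ => True) (upair x y)) as [z [Hz [_ K]]].
  - defn.
  - exists x. rewrite mem_upair. auto.
  - apply mem_upair in Hz. destruct Hz as [-> | ->].
    + apply (K y); trivial. apply mem_upair. auto.
    + apply (K x); trivial. apply mem_upair. auto.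
Qed.

Lemma ord_trans a b c : is_ordinal c -> a ∈ b -> b ∈ c -> a ∈ c.
Proof. intros [H _] Hab Hbc. exact (H b Hbc a Hab). Qed.

Lemma ord_mem a b : is_ordinal a -> b ∈ a -> is_ordinal b.
Proof.
  intros [H1 H2] Hb. split; [auto|]. intros c Hc. apply H2. exact (H1 b Hb c Hc).
Qed.

Lemma ord_succ a : is_ordinal a -> is_ordinal (succ a).
Proof.
  intros [H1 H2]. split.
  - intros b Hb c Hc. apply mem_succ in Hb. apply mem_succ.
    destruct Hb as [Hb| ->]; auto. left. exact (H1 b Hb c Hc).
  - intros b Hb. apply mem_succ in Hb. destruct Hb as [Hb| ->]; auto.
Qed.

Lemma mem_succ_self a : a ∈ succ a.
Proof. apply mem_succ. auto. Qed.

Lemma def_is_ordinal l (s : env V l -> V) : dt s -> def (fun g => is_ordinal (s g)).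
Proof. unfold is_ordinal, transitive_set. defn. Qed.
Hint Resolve def_is_ordinal : defdb.

Lemma ord_least (P : V -> Prop) : cls P -> (exists a, is_ordinal a /\ P a) ->
  exists a, is_ordinal a /\ P a /\ forall b, b ∈ a -> ~ P b.
Proof.
  intros HP [a [Ha Pa]].
  (* Foundation is applied inside [succ a]; by transitivity this set contains all elements of the
     minimal ordinal found. *)
  destruct (foundation P (succ a) HP) as [b [Hb [Pb H]]].
  { exists a. auto using mem_succ_self. }
  assert (Sb := ord_succ a Ha).
  exists b. split; [now apply (ord_mem (succ a))|]. split; trivial.
  intros c Hc Pc. apply (H c); trivial. exact (ord_trans c b _ Sb Hc Hb).
Qed.

Lemma ord_ind (P : V -> Prop) : cls P ->
  (forall a, is_ordinal a -> (forall b, b ∈ a -> P b) -> P a) ->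
  forall a, is_ordinal a -> P a.
Proof.
  intros HP IH a Ha. apply NNPP. intros Na.
  destruct (ord_least (fun a => ~ P a)) as [b [Hb [Nb H]]].
  - defn.
  - eauto.
  - apply Nb, IH; trivial. intros c Hc. apply NNPP. now apply H.
Qed.

Lemma ord_tri a b : is_ordinal a -> is_ordinal b -> a ∈ b \/ a = b \/ b ∈ a.
Proof.
  intros Ha. revert b.
  apply (ord_ind (fun a => forall b, is_ordinal b -> a ∈ b \/ a = b \/ b ∈ a));
    [defn| |exact Ha].
  clear a Ha. intros a Ha IHa.
  apply (ord_ind (fun b => a ∈ b \/ a = b \/ b ∈ a)); [defn|].
  intros b Hb IHb.
  (* Outside these two cases every element of one ordinal is, by induction, an element of the
     other. *)
  destruct (classic (exists c, c ∈ b /\ (a = c \/ a ∈ c))) as [[c [Hc [->|H]]]|N1]; auto.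
  { left. now apply (ord_trans a c). }
  destruct (classic (exists c, c ∈ a /\ (b = c \/ b ∈ c))) as [[c [Hc [->|H]]]|N2]; auto.
  { right. right. now apply (ord_trans b c). }
  right. left. apply ext. intros c. split; intros Hc.
  - destruct (IHa c Hc b Hb) as [H|[H|H]]; trivial; destruct N2; exists c; auto.
  - destruct (IHb c Hc) as [H|[H|H]]; trivial; destruct N1; exists c; auto.
Qed.

Lemma ord_emp : is_ordinal emp.
Proof. split; intros b Hb; destruct (mem_emp b Hb). Qed.

Lemma succ_inj x y : succ x = succ y -> x = y.
Proof.
  intros E. assert (H : x ∈ succ y) by (rewrite <- E; apply mem_succ_self).
  assert (K : y ∈ succ x) by (rewrite E; apply mem_succ_self).
  apply mem_succ in H. apply mem_succ in K. destruct H as [H|H]; auto.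
  destruct K as [K|K]; auto. destruct (mem_asym x y H K).
Qed.

Lemma succ_neq_emp x : succ x <> emp.
Proof. intros E. apply (mem_emp x). rewrite <- E. apply mem_succ_self. Qed.

(** Union undoes the successor on ordinals, which gives [natrec] its predecessor. *)
Lemma Un_succ n : is_ordinal n -> Un (succ n) = n.
Proof.
  intros [H _]. apply ext. intros z. rewrite mem_Un. split.
  - intros [y [Hy Hz]]. apply mem_succ in Hy. destruct Hy as [Hy| ->]; trivial.
    exact (H y Hy z Hz).
  - intros Hz. exists n. auto using mem_succ_self.
Qed.

Lemma inductiveP I : inductive_set I <-> emp ∈ I /\ forall n, n ∈ I -> succ n ∈ I.
Proof.
  unfold inductive_set. split.
  - intros [[z [Hz Iz]] H]. apply eq_emp in Hz. subst z. split; trivial.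
    intros n Hn. destruct (H n Hn) as [s [Hs K]]. apply is_succP in Hs. now subst.
  - intros [H1 H2]. split.
    + exists emp. split; trivial. exact mem_emp.
    + intros n Hn. exists (succ n). rewrite is_succP. auto.
Qed.

Lemma om_is_omega : is_omega om.
Proof.
  apply (theP is_omega).
  - destruct (ZF_infinity V hV) as [I HI].
    (* The least inductive set is the intersection of all inductive sets, cut out of one of them by
       Separation. *)
    set (P := fun x => forall J, emp ∈ J /\ (forall n, n ∈ J -> succ n ∈ J) -> x ∈ J).
    assert (HP : cls P).
    { unfold P. defn. }
    exists (sep I P). apply inductiveP in HI. split.
    + apply inductiveP. rewrite mem_sep by trivial. split.
      * split; [tauto|]. intros J HJ. tauto.
      * intros n Hn. apply mem_sep in Hn; trivial. apply mem_sep; trivial.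
        destruct Hn as [Hn K]. split; [now apply HI|].
        intros J HJ. apply HJ, K. tauto.
    + intros J HJ x Hx. apply inductiveP in HJ. apply mem_sep in Hx; trivial.
      now apply Hx.
  - intros y z [Hy1 Hy2] [Hz1 Hz2]. apply ext. intros w. split; [now apply Hy2|now apply Hz2].
Qed.

Lemma is_omegaP w : is_omega w <-> w = om.
Proof.
  split; [|intros ->; exact om_is_omega]. intros [H1 H2].
  destruct om_is_omega as [K1 K2]. apply ext. intros z. split; [now apply H2|now apply K2].
Qed.

Lemma emp_om : emp ∈ om.
Proof. apply (inductiveP om), om_is_omega. Qed.

Lemma succ_om n : n ∈ om -> succ n ∈ om.
Proof. apply (inductiveP om), om_is_omega. Qed.

Lemma nat_ind (P : V -> Prop) : cls P -> P emp ->
  (forall n, n ∈ om -> P n -> P (succ n)) -> forall n, n ∈ om -> P n.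
Proof.
  intros HP H0 HS n Hn.
  assert (K : subset om (sep om P)).
  { apply om_is_omega, inductiveP. rewrite mem_sep by trivial. split; [auto using emp_om|].
    intros m Hm. apply mem_sep in Hm; trivial. apply mem_sep; trivial.
    split; [apply succ_om|apply HS]; tauto. }
  apply K, mem_sep in Hn; tauto.
Qed.

Lemma nat_ord n : n ∈ om -> is_ordinal n.
Proof.
  revert n. apply nat_ind; [defn|exact ord_emp|]. intros n _. apply ord_succ.
Qed.

Lemma nat_case n : n ∈ om -> n = emp \/ exists m, m ∈ om /\ n = succ m.
Proof.
  revert n. apply nat_ind; [defn|auto|]. intros n Hn _. right. eauto.
Qed.

Lemma om_trans m n : m ∈ n -> n ∈ om -> m ∈ om.
Proof.
  intros Hm Hn. revert n Hn m Hm.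
  apply (nat_ind (fun n => forall m, m ∈ n -> m ∈ om)); [defn| |].
  - intros m Hm. destruct (mem_emp m Hm).
  - intros n Hn IH m Hm. apply mem_succ in Hm. destruct Hm as [Hm| ->]; auto.
Qed.

Definition least (P : V -> Prop) : V :=
  the (fun a => is_ordinal a /\ P a /\ forall b, b ∈ a -> ~ P b).

Lemma least_spec P : cls P -> (exists a, is_ordinal a /\ P a) ->
  is_ordinal (least P) /\ P (least P) /\ forall b, b ∈ least P -> ~ P b.
Proof.
  intros HP H.
  apply (theP (fun a => is_ordinal a /\ P a /\ forall b, b ∈ a -> ~ P b)).
  - now apply ord_least.
  - intros a b [Ha [Pa Ma]] [Hb [Pb Mb]].
    destruct (ord_tri a b Ha Hb) as [H'|[H'|H']]; trivial.
    + destruct (Mb a H' Pa).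
    + destruct (Ma b H' Pb).
Qed.

Lemma dt_least l (P : env V l -> V -> Prop) :
  def (fun g : env V (S l) => P (tl g) (hd g)) -> dt (fun g => least (P g)).
Proof. defu least. Qed.

(** Replacement along the inverse of [F] would turn [X] into a set containing every ordinal, and the
    set of all ordinals would be an ordinal belonging to itself. *)
Lemma no_ord_inj (X : V) F : op F -> (forall a, is_ordinal a -> F a ∈ X) ->
  (forall a b, is_ordinal a -> is_ordinal b -> F a = F b -> a = b) -> False.
Proof.
  intros HF HX Hinj.
  set (Y := repl X (fun x => the (fun a => is_ordinal a /\ F a = x))).
  assert (HY : forall a, is_ordinal a -> a ∈ Y).
  { intros a Ha. unfold Y. rewrite mem_repl by defn. exists (F a).
    split; [auto|]. symmetry. apply the_eq; [auto|]. intros b [Hb E]. auto. }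
  set (O := sep Y is_ordinal).
  assert (HO : forall a, a ∈ O <-> is_ordinal a).
  { intros a. unfold O. rewrite mem_sep by defn. split; [tauto|auto]. }
  apply (mem_irrefl O), HO. split.
  - intros a Ha b Hb. apply HO in Ha. apply HO. now apply (ord_mem a).
  - intros a Ha. apply HO in Ha. exact (proj1 Ha).
Qed.

(** * Recursion *)

(** An approximation is a fixed point: a function on [a] each of whose values is computed by [G]
    from its own restriction to the earlier arguments. *)
Definition approx (G : V -> V -> V) a f : Prop :=
  f = lam a (fun b => G b (lam b (ap f))).

Definition rec (G : V -> V -> V) a : V := G a (the (approx G a)).

Lemma dt_rec l (G : env V l -> V -> V -> V) s :
  dt (fun g : env V (S (S l)) => G (tl (tl g)) (hd (tl g)) (hd g)) -> dt s ->
  dt (fun g => rec (G g) (s g)).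
Proof. unfold rec, approx. defn. Qed.

Definition op2 (G : V -> V -> V) : Prop := dt (fun g : env V 2 => G (hd (tl g)) (hd g)).

Lemma dt_op2 l G (s t : env V l -> V) : op2 G -> dt s -> dt t -> dt (fun g => G (s g) (t g)).
Proof.
  intros HG Hs Ht. apply (dt_inst2 l l (fun _ => G) (fun g => g)); auto using dts_id.
  refine (dt_weak (S (S l)) 2 (fun g => ((tt, hd (tl g)), hd g) : env V 2) _ HG _).
  exact (dts_lift (S l) 1 _ (dts_hd l)).
Qed.
Hint Extern 3 (dt _) => match goal with
  | H : op2 _ |- _ => refine (dt_op2 _ _ _ _ H _ _) end : defdb.
Hint Resolve dt_rec : defdb.

Lemma approx_unique G a f f' : op2 G -> is_ordinal a ->
  approx G a f -> approx G a f' -> f = f'.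
Proof.
  intros HG Ha Hf Hf'.
  assert (K : forall b, is_ordinal b -> b ∈ a -> ap f b = ap f' b).
  { apply (ord_ind (fun b => b ∈ a -> ap f b = ap f' b)); [defn|].
    intros b Hb IH Hba. rewrite Hf, Hf'. rewrite !ap_lam by defn || trivial.
    rewrite (lam_ext b (ap f) (ap f')); trivial.
    intros c Hc. apply IH; trivial. now apply (ord_trans c b). }
  rewrite Hf, Hf'. apply lam_ext. intros b Hb.
  rewrite (lam_ext b (ap f) (ap f')); trivial.
  intros c Hc. apply K; [apply (ord_mem b)|apply (ord_trans c b)]; trivial.
  now apply (ord_mem a).
Qed.

(** By induction [rec] is an approximation on each [b] in [a]; uniqueness then evaluates the
    description inside [rec] at [b]. *)
Lemma approx_rec G a : op2 G -> is_ordinal a -> approx G a (lam a (rec G)).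
Proof.
  intros HG. apply (ord_ind (fun a => approx G a (lam a (rec G)))).
  { unfold approx. defn. }
  clear a. intros a Ha IH. unfold approx at 1. apply lam_ext. intros b Hb.
  unfold rec at 1. f_equal.
  rewrite (the_eq (approx G b) (lam b (rec G))).
  - apply lam_ext. intros c Hc. rewrite ap_lam by (defn || now apply (ord_trans c b)).
    reflexivity.
  - exact (IH b Hb).
  - intros f Hf. exact (approx_unique G b _ _ HG (ord_mem a b Ha Hb) Hf (IH b Hb)).
Qed.

Lemma rec_eq G a : op2 G -> is_ordinal a -> rec G a = G a (lam a (rec G)).
Proof.
  intros HG Ha. unfold rec at 1. f_equal. apply the_eq; [now apply approx_rec|].
  intros f Hf. exact (approx_unique G a _ _ HG Ha Hf (approx_rec G a HG Ha)).
Qed.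

(** [Un m] is the predecessor of [m], so [g] receives the previous index and the previous value. *)
Definition natrec a (g : V -> V -> V) n : V :=
  rec (fun m f => the (fun y => (m = emp /\ y = a) \/
    (m <> emp /\ y = g (Un m) (ap f (Un m))))) n.

Lemma dt_emp l : dt (fun _ : env V l => emp).
Proof. apply dt_const. Qed.
Hint Resolve dt_emp : defdb.

Lemma dt_natrec l (a : env V l -> V) (G : env V l -> V -> V -> V) s : dt a ->
  dt (fun g : env V (S (S l)) => G (tl (tl g)) (hd (tl g)) (hd g)) -> dt s ->
  dt (fun g => natrec (a g) (G g) (s g)).
Proof. defu natrec. Qed.

Lemma natrec_0 a g : op2 g -> natrec a g emp = a.
Proof.
  intros Hg. unfold natrec. rewrite rec_eq; [|unfold op2; defn|exact ord_emp].
  apply the_eq; [auto|]. intros y [[_ ->]|[H _]]; trivial. now destruct H.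
Qed.

Lemma natrec_S a g n : op2 g -> n ∈ om -> natrec a g (succ n) = g n (natrec a g n).
Proof.
  intros Hg Hn. unfold natrec at 1. rewrite rec_eq;
    [|unfold op2; defn|apply nat_ord; now apply succ_om].
  rewrite Un_succ by now apply nat_ord.
  rewrite ap_lam by (defn || apply mem_succ_self).
  apply the_eq; [right; split; [apply succ_neq_emp|reflexivity]|].
  intros y [[H _]|[_ ->]]; trivial. now apply succ_neq_emp in H.
Qed.
End Ordinals.
#[export] Hint Resolve def_is_ordinal dt_least dt_rec dt_emp dt_natrec : defdb.
#[export] Hint Extern 3 (dt _) => match goal with
  | H : op2 _ |- _ => refine (dt_op2 _ _ _ _ H _ _) end : defdb.
#[export] Hint Extern 1 (op2 _) => unfold op2; cbv beta : defdb.
#[global] Opaque om lam least rec natrec.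
(** * Countable and finite sets *)
Section Countable.
Context {V : set_structure} {hV : ZF V}.
Implicit Types x y z a b c f n m k : V.

Definition dbl n : V := natrec emp (fun _ x => succ (succ x)) n.

(** [2 ^ m * (2 * n + 1) - 1] *)
Definition pr m n : V := natrec (dbl n) (fun _ x => succ (dbl x)) m.

Lemma dt_dbl l (s : env V l -> V) : dt s -> dt (fun g => dbl (s g)).
Proof. defu dbl. Qed.
Hint Resolve dt_dbl : defdb.

Lemma dt_pr l (s t : env V l -> V) : dt s -> dt t -> dt (fun g => pr (s g) (t g)).
Proof. defu pr. Qed.
Hint Resolve dt_pr : defdb.

Lemma dbl_0 : dbl emp = emp.
Proof. unfold dbl. rewrite natrec_0; [reflexivity|defn]. Qed.

Lemma dbl_S n : n ∈ om -> dbl (succ n) = succ (succ (dbl n)).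
Proof. intros H. unfold dbl. rewrite natrec_S; [reflexivity|defn|trivial]. Qed.

Lemma dbl_om n : n ∈ om -> dbl n ∈ om.
Proof.
  revert n. apply nat_ind; [defn|rewrite dbl_0; exact emp_om|].
  intros n Hn IH. rewrite dbl_S by trivial. now apply succ_om, succ_om.
Qed.

Lemma dbl_inj m n : m ∈ om -> n ∈ om -> dbl m = dbl n -> m = n.
Proof.
  intros Hm. revert m Hm n.
  apply (nat_ind (fun m => forall n, n ∈ om -> dbl m = dbl n -> m = n)); [defn| |].
  - intros n Hn. destruct (nat_case n Hn) as [->|[k [Hk ->]]]; trivial.
    rewrite dbl_0, dbl_S by trivial. intros E. symmetry in E. now apply succ_neq_emp in E.
  - intros m Hm IH n Hn. destruct (nat_case n Hn) as [->|[k [Hk ->]]].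
    + rewrite dbl_0, dbl_S by trivial. intros E. now apply succ_neq_emp in E.
    + rewrite !dbl_S by trivial. intros E. apply succ_inj, succ_inj in E.
      f_equal. now apply IH.
Qed.

Lemma dbl_parity m n : m ∈ om -> n ∈ om -> dbl m <> succ (dbl n).
Proof.
  intros Hm. revert m Hm n.
  apply (nat_ind (fun m => forall n, n ∈ om -> dbl m <> succ (dbl n))); [defn| |].
  - intros n Hn E. rewrite dbl_0 in E. symmetry in E. now apply succ_neq_emp in E.
  - intros m Hm IH n Hn E. rewrite dbl_S in E by trivial. apply succ_inj in E.
    destruct (nat_case n Hn) as [->|[k [Hk ->]]].
    + rewrite dbl_0 in E. now apply succ_neq_emp in E.
    + rewrite dbl_S in E by trivial. apply succ_inj in E. now apply (IH k).
Qed.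

Lemma pr_0 n : pr emp n = dbl n.
Proof. unfold pr. rewrite natrec_0; [reflexivity|defn]. Qed.

Lemma pr_S m n : m ∈ om -> pr (succ m) n = succ (dbl (pr m n)).
Proof. intros H. unfold pr. rewrite natrec_S; [reflexivity|defn|trivial]. Qed.

Lemma pr_om m n : m ∈ om -> n ∈ om -> pr m n ∈ om.
Proof.
  intros Hm Hn. revert m Hm. apply nat_ind; [defn|rewrite pr_0; now apply dbl_om|].
  intros m Hm IH. rewrite pr_S by trivial. now apply succ_om, dbl_om.
Qed.

(** Codes with first component zero are even and all others odd, so the first component is recovered
    by repeated halving and the second by injectivity of doubling. *)
Lemma pr_inj m n m' n' : m ∈ om -> n ∈ om -> m' ∈ om -> n' ∈ om ->
  pr m n = pr m' n' -> m = m' /\ n = n'.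
Proof.
  intros Hm Hn Hm' Hn'. revert m Hm m' Hm'.
  apply (nat_ind (fun m => forall m', m' ∈ om -> pr m n = pr m' n' -> m = m' /\ n = n'));
    [defn| |].
  - intros m' Hm'. destruct (nat_case m' Hm') as [->|[k [Hk ->]]].
    + rewrite !pr_0. intros E. split; trivial. now apply dbl_inj.
    + rewrite pr_0, pr_S by trivial. intros E. apply dbl_parity in E; trivial.
      tauto. now apply pr_om.
  - intros m Hm IH m' Hm'. destruct (nat_case m' Hm') as [->|[k [Hk ->]]].
    + rewrite pr_0, pr_S by trivial. intros E. symmetry in E.
      apply dbl_parity in E; trivial. tauto. now apply pr_om.
    + rewrite !pr_S by trivial. intros E. apply succ_inj, dbl_inj in E; try now apply pr_om.
      destruct (IH k Hk E) as [-> ->]. auto.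
Qed.

Lemma countable_intro A F : op F -> (forall x, x ∈ A -> F x ∈ om) ->
  (forall x y, x ∈ A -> y ∈ A -> F x = F y -> x = y) -> countable A.
Proof.
  intros HF H1 H2. exists om, (lam A F). split; [exact om_is_omega|].
  assert (K : is_fun (lam A F) A om) by now apply is_fun_lam.
  split; trivial. apply (injectiveP _ A om K). intros x y Hx Hy.
  rewrite !ap_lam by trivial. auto.
Qed.

Lemma countable_elim A : countable A -> exists f,
  (forall x, x ∈ A -> ap f x ∈ om) /\
  (forall x y, x ∈ A -> y ∈ A -> ap f x = ap f y -> x = y).
Proof.
  intros [w [f [Hw [Hf Hi]]]]. apply is_omegaP in Hw. subst w. exists f. split.
  - intros x. now apply fun_in.
  - now apply (injectiveP _ A om Hf).
Qed.

Lemma countable_inj A B F : op F -> countable B -> (forall x, x ∈ A -> F x ∈ B) ->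
  (forall x y, x ∈ A -> y ∈ A -> F x = F y -> x = y) -> countable A.
Proof.
  intros HF HB H1 H2. destruct (countable_elim B HB) as [f [Hf1 Hf2]].
  apply (countable_intro A (fun x => ap f (F x))); [defn|auto|auto].
Qed.

(** Taking the least related number turns the relation into an injection without any choice. *)
Lemma countable_rel A (P : V -> V -> Prop) :
  def (fun g : env V 2 => P (hd (tl g)) (hd g)) ->
  (forall x, x ∈ A -> exists n, n ∈ om /\ P x n) ->
  (forall x y n, x ∈ A -> y ∈ A -> n ∈ om -> P x n -> P y n -> x = y) -> countable A.
Proof.
  intros HP H1 H2.
  assert (DP : forall l (s t : env V l -> V), dt s -> dt t -> def (fun g => P (s g) (t g))).
  { intros l s t Hs Ht. apply (def_inst2 l l (fun _ => P) (fun g => g)); auto using dts_id.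
    exact (def_subst (S (S l)) 2 _ _ (dts_lift (S l) 1 _ (dts_hd l)) HP). }
  assert (K : forall x, x ∈ A -> least (fun n => n ∈ om /\ P x n) ∈ om /\
    P x (least (fun n => n ∈ om /\ P x n))).
  { intros x Hx.
    destruct (least_spec (fun n => n ∈ om /\ P x n)) as [_ [H _]]; trivial.
    - apply def_and; [defn|apply DP; defn].
    - destruct (H1 x Hx) as [n [Hn Pn]]. exists n. split; [now apply nat_ord|auto]. }
  apply (countable_intro A (fun x => least (fun n => n ∈ om /\ P x n))).
  - apply dt_least, def_and; [defn|apply DP; defn].
  - intros x Hx. now apply K.
  - intros x y Hx Hy E. apply (H2 x y (least (fun n => n ∈ om /\ P x n))); trivial.
    + now apply K.
    + now apply K.
    + rewrite E. now apply K.
Qed.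

Lemma countable_succ a : countable a -> countable (succ a).
Proof.
  intros Ha. destruct (countable_elim a Ha) as [f [F1 F2]].
  apply (countable_rel _ (fun x n => (x ∈ a /\ n = succ (ap f x)) \/ (x = a /\ n = emp))).
  - defn.
  - intros x Hx. apply mem_succ in Hx. destruct Hx as [Hx| ->].
    + exists (succ (ap f x)). auto using succ_om.
    + exists emp. auto using emp_om.
  - intros x y n _ _ _ [[Hx ->]|[-> ->]] [[Hy E]|[-> E]]; trivial.
    + apply succ_inj in E. auto.
    + now apply succ_neq_emp in E.
    + symmetry in E. now apply succ_neq_emp in E.
Qed.

(** * Finite sets of natural numbers and eventual equality of sequences *)

Lemma def_app l (s t u : env V l -> V) : dt s -> dt t -> dt u ->
  def (fun g => app (s g) (t g) (u g)).
Proof. unfold app, is_opair. defn. Qed.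
Hint Resolve def_app : defdb.

Lemma def_is_fun l (s t u : env V l -> V) : dt s -> dt t -> dt u ->
  def (fun g => is_fun (s g) (t g) (u g)).
Proof. unfold is_fun, is_opair, unique. defn. Qed.
Hint Resolve def_is_fun : defdb.

Lemma fun_ap f a b x : is_fun f a b -> x ∈ a -> app f x (ap f x).
Proof. intros H Hx. now apply (app_fun f a b). Qed.

Definition bijects A n : Prop := exists f, is_fun f A n /\
  (forall x y, x ∈ A -> y ∈ A -> ap f x = ap f y -> x = y) /\
  forall y, y ∈ n -> exists x, x ∈ A /\ ap f x = y.

Lemma def_bijects l (s t : env V l -> V) : dt s -> dt t ->
  def (fun g => bijects (s g) (t g)).
Proof. defu bijects. Qed.
Hint Resolve def_bijects : defdb.

Lemma finiteP A : finite A <-> exists n, n ∈ om /\ bijects A n.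
Proof.
  unfold finite, bijects. split.
  - intros [w [n [f [Hw [Hn [Hf [Hi Ho]]]]]]]. apply is_omegaP in Hw. subst w.
    exists n. split; trivial. exists f. split; trivial. split.
    + now apply (injectiveP f A n).
    + intros y Hy. destruct (Ho y Hy) as [x Hx]. apply (app_fun f A n) in Hx; trivial.
      exists x. intuition.
  - intros [n [Hn [f [Hf [Hi Ho]]]]]. exists om, n, f.
    split; [exact om_is_omega|]. split; [trivial|]. split; [trivial|]. split.
    + now apply (injectiveP f A n).
    + intros y Hy. destruct (Ho y Hy) as [x [Hx <-]]. exists x. now apply (fun_ap f A n).
Qed.

(** Induction on the bound: a subset of [succ m] containing [m] is numbered by sending [m] to one
    new number above those used for the rest. *)
Lemma bounded_finite m : m ∈ om -> forall A, subset A m -> exists n, n ∈ om /\ bijects A n.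
Proof.
  revert m.
  apply (nat_ind (fun m => forall A, subset A m -> exists n, n ∈ om /\ bijects A n)); [defn| |].
  - intros A HA. exists emp. split; [exact emp_om|]. exists (lam A (fun x => x)).
    split; [|split].
    + apply is_fun_lam; [defn|]. auto.
    + intros x y Hx. destruct (mem_emp _ (HA x Hx)).
    + intros y Hy. destruct (mem_emp _ Hy).
  - intros m Hm IH A HA. destruct (classic (m ∈ A)) as [HmA|HmA].
    2:{ apply IH. intros x Hx. destruct (proj1 (mem_succ _ _) (HA x Hx)) as [H| ->]; tauto. }
    destruct (IH (sep A (fun x => x ∈ m))) as [n [Hn [f [Hf [Hi Ho]]]]].
    { intros x Hx. rewrite mem_sep in Hx by defn. tauto. }
    assert (HB : forall x, x ∈ A -> x ∈ m -> x ∈ sep A (fun x => x ∈ m)).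
    { intros x H1 H2. rewrite mem_sep by defn. auto. }
    exists (succ n). split; [now apply succ_om|].
    set (F := fun x => the (fun y => (x ∈ m /\ y = ap f x) \/ (x = m /\ y = n))).
    assert (DF : op F) by (unfold F; defn).
    assert (F1 : forall x, x ∈ m -> F x = ap f x).
    { intros x Hx. apply the_eq; [auto|]. intros z [[_ E]|[-> _]]; trivial.
      destruct (mem_irrefl _ Hx). }
    assert (F2 : F m = n).
    { apply the_eq; [auto|]. intros z [[H _]|[_ E]]; trivial. destruct (mem_irrefl _ H). }
    assert (F3 : forall x, x ∈ A -> x ∈ m -> F x ∈ n).
    { intros x H1 H2. rewrite F1 by trivial. apply (fun_in f _ _ x Hf). auto. }
    assert (C : forall x, x ∈ A -> x ∈ m \/ x = m).
    { intros x Hx. apply mem_succ, HA, Hx. }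
    exists (lam A F). split; [|split].
    + apply is_fun_lam; trivial. intros x Hx. apply mem_succ.
      destruct (C x Hx) as [H| ->]; auto.
    + intros x y Hx Hy. rewrite !ap_lam by trivial. intros E.
      destruct (C x Hx) as [H1| ->], (C y Hy) as [H2| ->]; trivial.
      * rewrite !F1 in E by trivial. auto.
      * rewrite F2 in E. destruct (mem_irrefl n). rewrite <- E at 1. auto.
      * rewrite F2 in E. destruct (mem_irrefl n). rewrite E at 1. auto.
    + intros y Hy. apply mem_succ in Hy. destruct Hy as [Hy| ->].
      * destruct (Ho y Hy) as [x [Hx <-]]. rewrite mem_sep in Hx by defn.
        exists x. rewrite ap_lam by tauto. intuition.
      * exists m. rewrite ap_lam by trivial. auto.
Qed.

(** Induction on the size: the element sent to the last number, if there is one, is added to a bound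
    for the others. *)
Lemma finite_bounded n : n ∈ om -> forall A f, subset A om ->
  (forall x, x ∈ A -> ap f x ∈ n) ->
  (forall x y, x ∈ A -> y ∈ A -> ap f x = ap f y -> x = y) ->
  exists m, m ∈ om /\ subset A m.
Proof.
  revert n.
  apply (nat_ind (fun n => forall A f, subset A om ->
   (forall x, x ∈ A -> ap f x ∈ n) ->
   (forall x y, x ∈ A -> y ∈ A -> ap f x = ap f y -> x = y) ->
   exists m, m ∈ om /\ subset A m)); [defn| |].
  - intros A f _ H _. exists emp. split; [exact emp_om|]. intros x Hx.
    destruct (mem_emp _ (H x Hx)).
  - intros n Hn IH A f HA Hf Hi.
    destruct (IH (sep A (fun x => ap f x ∈ n)) f) as [m [Hm Hs]].
    + intros x Hx. rewrite mem_sep in Hx by defn. apply HA. tauto.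
    + intros x Hx. rewrite mem_sep in Hx by defn. tauto.
    + intros x y Hx Hy. rewrite mem_sep in Hx, Hy by defn. apply Hi; tauto.
    + destruct (classic (exists x, x ∈ A /\ ap f x = n)) as [[x [Hx E]]|N].
      * assert (Hxo := HA x Hx).
        assert (K : exists k, k ∈ om /\ subset m k /\ x ∈ k).
        { destruct (ord_tri m x) as [H|[H|H]]; try now apply nat_ord.
          - exists (succ x). split; [now apply succ_om|]. split; [|apply mem_succ_self].
            intros z Hz. apply mem_succ. left. apply (ord_trans z m x); trivial. now apply nat_ord.
          - subst m. exists (succ x). split; [now apply succ_om|]. split; [|apply mem_succ_self].
            intros z Hz. apply mem_succ. auto.
          - exists m. split; [trivial|]. split; [|trivial]. intros z Hz. exact Hz. }
        destruct K as [k [Hk [K1 K2]]]. exists k. split; trivial.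
        intros y Hy. destruct (proj1 (mem_succ _ _) (Hf y Hy)) as [H|H].
        -- apply K1, Hs. rewrite mem_sep by defn. auto.
        -- replace y with x; trivial. apply Hi; trivial. congruence.
      * exists m. split; trivial. intros y Hy. apply Hs. rewrite mem_sep by defn.
        split; trivial. destruct (proj1 (mem_succ _ _) (Hf y Hy)) as [H|H]; trivial.
        destruct N. eauto.
Qed.

Lemma is_seqP R x : is_seq R x <-> is_fun x om R.
Proof.
  split.
  - intros [w [Hw H]]. apply is_omegaP in Hw. now subst.
  - intros H. exists om. auto using om_is_omega.
Qed.

(** A set of natural numbers is finite exactly when it is bounded, so finite difference means
    agreement from some [m] on. *)
Lemma E1P R x y : E1 R x y <-> is_fun x om R /\ is_fun y om R /\
  exists m, m ∈ om /\ forall n, n ∈ om -> n ∉ m -> ap x n = ap y n.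
Proof.
  unfold E1. rewrite !is_seqP. split.
  - intros [Hx [Hy [D [HD HF]]]]. split; [trivial|]. split; [trivial|].
    assert (KD : forall n, n ∈ D <-> n ∈ om /\ ap x n <> ap y n).
    { intros n. rewrite HD. split.
      - intros [a [b [Ha [Hb N]]]]. apply (app_fun _ _ _ _ _ Hx) in Ha.
        apply (app_fun _ _ _ _ _ Hy) in Hb. intuition congruence.
      - intros [Hn N]. exists (ap x n), (ap y n). split; [now apply (fun_ap _ _ _ _ Hx)|].
        split; [now apply (fun_ap _ _ _ _ Hy)|trivial]. }
    apply finiteP in HF. destruct HF as [n [Hn [f [Hf [Hi _]]]]].
    destruct (finite_bounded n Hn D f) as [m [Hm Hs]]; trivial.
    + intros k Hk. now apply KD in Hk.
    + intros k Hk. now apply (fun_in _ _ _ _ Hf).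
    + exists m. split; trivial. intros k Hk Hkm. apply NNPP. intros N.
      apply Hkm, Hs, KD. auto.
  - intros [Hx [Hy [m [Hm H]]]]. split; [trivial|]. split; [trivial|].
    exists (sep om (fun n => ap x n <> ap y n)). split.
    + intros n. rewrite mem_sep by defn. split.
      * intros [Hn N]. exists (ap x n), (ap y n). split; [now apply (fun_ap _ _ _ _ Hx)|].
        split; [now apply (fun_ap _ _ _ _ Hy)|trivial].
      * intros [a [b [Ha [Hb N]]]]. apply (app_fun _ _ _ _ _ Hx) in Ha.
        apply (app_fun _ _ _ _ _ Hy) in Hb. intuition congruence.
    + apply finiteP, (bounded_finite m Hm). intros n Hn. rewrite mem_sep in Hn by defn.
      apply NNPP. intros N. now apply (proj2 Hn), H.
Qed.
End Countable.
#[export] Hint Resolve dt_dbl dt_pr def_app def_is_fun : defdb.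
#[global] Opaque dbl pr.
(** * Coding sequences of reals by reals *)
Section Reals.
Context {V : set_structure} {hV : ZF V}.

Definition bin (f x y : V) : V := ap f (opair x y).

Lemma dt_bin l (s t u : env V l -> V) : dt s -> dt t -> dt u ->
  dt (fun g => bin (s g) (t g) (u g)).
Proof. defu bin. Qed.
Hint Resolve dt_bin : defdb.

Lemma app2P f R x y z : is_binop f R -> app2 f x y z <-> x ∈ R /\ y ∈ R /\ z = bin f x y.
Proof.
  intros [R2 [H2 Hf]]. apply is_prodP in H2. subst R2. unfold app2. split.
  - intros [p [Hp H]]. apply is_opairP in Hp. subst p.
    apply (app_fun _ _ _ _ _ Hf) in H. destruct H as [H ->].
    apply mem_prod in H. destruct H as [x' [y' [Hx [Hy E]]]].
    apply opair_inj in E. destruct E as [-> ->]. auto.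
  - intros [Hx [Hy ->]]. exists (opair x y). split; [now apply is_opairP|].
    apply (fun_ap _ _ _ _ Hf). apply mem_prod. eauto.
Qed.

Lemma bin_in f R x y : is_binop f R -> x ∈ R -> y ∈ R -> bin f x y ∈ R.
Proof.
  intros [R2 [H2 Hf]] Hx Hy. apply is_prodP in H2. subst R2.
  apply (fun_in _ _ _ _ Hf), mem_prod. eauto.
Qed.

(** * Arithmetic and order in a complete ordered field *)

Context {R add mul le zero one : V}.
Context (HR : complete_ordered_field R add mul le zero one).

(** Collecting the elements of [R] in a type makes ring computations available; definability is
    still stated for the underlying elements. *)
Definition Rt : Type := {x : V | x ∈ R}.
Implicit Types a b c d : Rt.

Definition vl a : V := proj1_sig a.

Lemma vl_in a : vl a ∈ R.
Proof. exact (proj2_sig a). Qed.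

Lemma vl_inj a b : vl a = vl b -> a = b.
Proof.
  destruct a as [x Hx], b as [y Hy]. simpl. intros <-. f_equal. apply proof_irrelevance.
Qed.

Definition r0 : Rt := exist _ zero (cof_zero_in _ _ _ _ _ _ HR).
Definition r1 : Rt := exist _ one (cof_one_in _ _ _ _ _ _ HR).
Definition radd a b : Rt := exist _ (bin add (vl a) (vl b))
  (bin_in _ _ _ _ (cof_add_op _ _ _ _ _ _ HR) (vl_in a) (vl_in b)).
Definition rmul a b : Rt := exist _ (bin mul (vl a) (vl b))
  (bin_in _ _ _ _ (cof_mul_op _ _ _ _ _ _ HR) (vl_in a) (vl_in b)).
Definition rle a b : Prop := app le (vl a) (vl b).
Definition ropp a : Rt := epsilon (inhabits r0) (fun b => radd a b = r0).
Definition rsub a b : Rt := radd a (ropp b).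

(** The junk value outside [R] is [0]. *)
Definition rep (x : V) : Rt :=
  match excluded_middle_informative (x ∈ R) with
  | left H => exist _ x H
  | right _ => r0
  end.

Lemma rep_vl x : x ∈ R -> vl (rep x) = x.
Proof.
  intros H. unfold rep. destruct (excluded_middle_informative (x ∈ R)); [reflexivity|tauto].
Qed.

Lemma addP a b z : app2 add (vl a) (vl b) z <-> z = vl (radd a b).
Proof.
  rewrite (app2P _ R) by apply HR. simpl. intuition; apply vl_in.
Qed.

Lemma mulP a b z : app2 mul (vl a) (vl b) z <-> z = vl (rmul a b).
Proof.
  rewrite (app2P _ R) by apply HR. simpl. intuition; apply vl_in.
Qed.

Lemma ropp_spec a : radd a (ropp a) = r0.
Proof.
  unfold ropp. apply epsilon_spec.
  destruct (cof_opp _ _ _ _ _ _ HR (vl a) (vl_in a)) as [y Hy].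
  assert (Ry : y ∈ R) by (apply (app2P _ R) in Hy; [tauto|apply HR]).
  exists (rep y). apply vl_inj. symmetry. apply addP. now rewrite rep_vl.
Qed.

Lemma R_ring : ring_theory r0 r1 radd rmul rsub ropp eq.
Proof.
  assert (AC : forall a b, radd a b = radd b a).
  { intros a b. apply vl_inj. apply addP, (cml_comm _ _ _ (cof_add _ _ _ _ _ _ HR)).
    now apply addP. }
  assert (MC : forall a b, rmul a b = rmul b a).
  { intros a b. apply vl_inj. apply mulP, (cml_comm _ _ _ (cof_mul _ _ _ _ _ _ HR)).
    now apply mulP. }
  split; trivial.
  - intros a. rewrite AC. apply vl_inj. symmetry. apply addP.
    apply (cml_unit _ _ _ (cof_add _ _ _ _ _ _ HR)), vl_in.
  - intros a b c. symmetry. apply vl_inj, addP.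
    apply (cml_assoc _ _ _ (cof_add _ _ _ _ _ _ HR) (vl a) (vl b) (vl c)
      (vl (radd a b)) (vl (radd b c))); now apply addP.
  - intros a. rewrite MC. apply vl_inj. symmetry. apply mulP.
    apply (cml_unit _ _ _ (cof_mul _ _ _ _ _ _ HR)), vl_in.
  - intros a b c. symmetry. apply vl_inj, mulP.
    apply (cml_assoc _ _ _ (cof_mul _ _ _ _ _ _ HR) (vl a) (vl b) (vl c)
      (vl (rmul a b)) (vl (rmul b c))); now apply mulP.
  - intros a b c. rewrite (MC (radd a b) c), (MC a c), (MC b c).
    apply vl_inj, addP.
    apply (cof_distr _ _ _ _ _ _ HR (vl c) (vl a) (vl b) (vl (radd a b)));
      first [now apply addP|now apply mulP].
  - apply ropp_spec.
Qed.
Add Ring R_ring_inst : R_ring.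

Lemma rle_total a b : rle a b \/ rle b a.
Proof. apply (cof_le_total _ _ _ _ _ _ HR); apply vl_in. Qed.

Lemma rle_refl a : rle a a.
Proof. destruct (rle_total a a); trivial. Qed.

Lemma rle_antisym a b : rle a b -> rle b a -> a = b.
Proof. intros. apply vl_inj, (cof_le_antisym _ _ _ _ _ _ HR); trivial using vl_in. Qed.

Lemma rle_trans a b c : rle a b -> rle b c -> rle a c.
Proof. apply (cof_le_trans _ _ _ _ _ _ HR); apply vl_in. Qed.

Lemma rle_add a b c : rle a b -> rle (radd a c) (radd b c).
Proof.
  intros H. apply (cof_le_add _ _ _ _ _ _ HR (vl a) (vl b) (vl c)); trivial using vl_in;
  now apply addP.
Qed.

Lemma rle_sub a b : rle a b <-> rle r0 (rsub b a).
Proof.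
  split; intros H.
  - replace r0 with (radd a (ropp a)) by ring. now apply rle_add.
  - apply (rle_add _ _ a) in H. replace (radd r0 a) with a in H by ring.
    now replace (radd (rsub b a) a) with b in H by ring.
Qed.

Lemma nn_add a b : rle r0 a -> rle r0 b -> rle r0 (radd a b).
Proof.
  intros Ha Hb. apply (rle_trans _ b); trivial.
  apply (rle_add _ _ b) in Ha. now replace (radd r0 b) with b in Ha by ring.
Qed.

(** Linear arithmetic: an inequality follows from others when the difference of its sides is
    the sum of theirs. *)
Lemma lin1 a b c d : rle a b -> rsub d c = rsub b a -> rle c d.
Proof. intros H E. apply rle_sub. rewrite E. now apply (rle_sub a b). Qed.

Lemma lin2 a b a' b' c d : rle a b -> rle a' b' ->
  rsub d c = radd (rsub b a) (rsub b' a') -> rle c d.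
Proof.
  intros H H' E. apply rle_sub. rewrite E.
  apply nn_add; [now apply (rle_sub a b)|now apply (rle_sub a' b')].
Qed.

Lemma lin3 a b a' b' a'' b'' c d : rle a b -> rle a' b' -> rle a'' b'' ->
  rsub d c = radd (radd (rsub b a) (rsub b' a')) (rsub b'' a'') -> rle c d.
Proof.
  intros H H' H'' E. apply rle_sub. rewrite E.
  apply nn_add; [apply nn_add|]; [now apply (rle_sub a b)|now apply (rle_sub a' b')|
    now apply (rle_sub a'' b'')].
Qed.

(** The order is total, so this is strict positivity. *)
Definition pos a : Prop := ~ rle a r0.

Lemma pos_le a : pos a -> rle r0 a.
Proof. intros H. destruct (rle_total r0 a); trivial. now destruct H. Qed.

Definition thr a : Rt := radd (radd a a) a.

(** If one were nonpositive, minus one would be nonnegative, and so would its square, which is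
    one. *)
Lemma pos_r1 : pos r1.
Proof.
  intros H. apply (cof_one_neq_zero _ _ _ _ _ _ HR).
  change (vl r1 = vl r0). f_equal. apply rle_antisym; trivial.
  assert (K : rle r0 (ropp r1)) by (apply (lin1 r1 r0); [trivial|ring]).
  replace r1 with (rmul (ropp r1) (ropp r1)) by ring.
  apply (cof_le_mul _ _ _ _ _ _ HR (vl (ropp r1)) (vl (ropp r1))); trivial using vl_in.
  now apply mulP.
Qed.

Lemma thr_bij : exists i, forall a, thr (rmul a i) = a /\ rmul (thr a) i = a.
Proof.
  (* If three were zero, minus one would equal one plus one and hence be nonnegative. *)
  assert (N : thr r1 <> r0).
  { intros E. apply pos_r1. unfold thr in E.
    apply (lin2 r0 r1 r0 r1); [apply pos_le, pos_r1|apply pos_le, pos_r1|].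
    transitivity (rsub (radd (rsub r1 r0) (rsub r1 r0)) (radd (radd r1 r1) r1)); [ring|].
    rewrite E. ring. }
  destruct (cof_inv _ _ _ _ _ _ HR (vl (thr r1)) (vl_in _)) as [y Hy].
  { intros E. apply N, vl_inj, E. }
  assert (Ry : y ∈ R) by (apply (app2P _ R) in Hy; [tauto|apply HR]).
  exists (rep y). assert (K : rmul (thr r1) (rep y) = r1).
  { apply vl_inj. symmetry. apply mulP. now rewrite rep_vl. }
  intros a. unfold thr in *. split.
  - transitivity (rmul a (rmul (radd (radd r1 r1) r1) (rep y))); [ring|]. rewrite K. ring.
  - transitivity (rmul a (rmul (radd (radd r1 r1) r1) (rep y))); [ring|]. rewrite K. ring.
Qed.

(** The powers of [1/3]. *)
Definition third (x : V) : V := the (fun y => y ∈ R /\ bin add (bin add y y) y = x).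
Definition h (n : V) : V := natrec one (fun _ x => third x) n.
Definition H n : Rt := rep (h n).

Lemma dt_third l (s : env V l -> V) : dt s -> dt (fun g => third (s g)).
Proof. defu third. Qed.
Hint Resolve dt_third : defdb.
Lemma dt_h l (s : env V l -> V) : dt s -> dt (fun g => h (s g)).
Proof. defu h. Qed.
Hint Resolve dt_h : defdb.

Lemma third_spec a : exists b, third (vl a) = vl b /\ thr b = a.
Proof.
  destruct thr_bij as [i Hi]. exists (rmul a i). split; [|exact (proj1 (Hi a))].
  apply the_eq.
  - split; [apply vl_in|]. exact (f_equal vl (proj1 (Hi a))).
  - intros y [Hy E]. rewrite <- (rep_vl y Hy) in *. f_equal.
    rewrite <- (proj2 (Hi (rep y))). f_equal. apply vl_inj, E.
Qed.

Lemma h_in n : n ∈ om -> h n ∈ R.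
Proof.
  revert n. apply nat_ind; [defn| |].
  - unfold h. rewrite natrec_0 by defn. apply HR.
  - intros n Hn IH. unfold h. rewrite natrec_S by (defn || trivial). fold (h n).
    destruct (third_spec (rep (h n))) as [b [E _]]. rewrite rep_vl in E by trivial.
    rewrite E. apply vl_in.
Qed.

Lemma H_vl n : n ∈ om -> vl (H n) = h n.
Proof. intros Hn. now apply rep_vl, h_in. Qed.

Lemma H_S n : n ∈ om -> thr (H (succ n)) = H n.
Proof.
  intros Hn. destruct (third_spec (H n)) as [b [E <-]]. f_equal.
  apply vl_inj. rewrite H_vl by now apply succ_om.
  unfold h. rewrite natrec_S by (defn || trivial). fold (h n).
  now rewrite <- H_vl by trivial.
Qed.

Lemma pos_thr a : pos (thr a) -> pos a.
Proof.
  intros Hp Ha. apply Hp. unfold thr. apply (lin3 a r0 a r0 a r0); trivial. ring.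
Qed.

Lemma H_pos n : n ∈ om -> pos (H n).
Proof.
  intros Hn. assert (K : ~ app le (h n) zero).
  { revert n Hn. apply nat_ind; [defn| |].
    - unfold h. rewrite natrec_0 by defn. exact pos_r1.
    - intros n Hn IH. rewrite <- H_vl in * by auto using succ_om.
      apply pos_thr. now rewrite H_S. }
  rewrite <- H_vl in K by trivial. exact K.
Qed.

(** Completeness enters here: if [s] is the supremum of [A], closure under the shift makes [s - d]
    an upper bound too. *)
Lemma no_bounded_shift (A : V) b d : subset A R -> (exists x, x ∈ A) ->
  (forall a, vl a ∈ A -> rle a b) -> pos d ->
  (forall a, vl a ∈ A -> vl (radd a d) ∈ A) -> False.
Proof.
  intros HA NA Hb Hd Hs.
  destruct (cof_sup _ _ _ _ _ _ HR A HA NA) as [s [[Rs Hs1] Hs2]].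
  { exists (vl b). split; [apply vl_in|]. intros x Hx. rewrite <- (rep_vl x) in * by auto.
    now apply Hb. }
  assert (K : rle (rep s) (rsub (rep s) d)).
  { unfold rle. rewrite rep_vl at 1 by trivial. apply Hs2. split; [apply vl_in|].
    intros x Hx. rewrite <- (rep_vl x) in * by auto.
    assert (L : rle (radd (rep x) d) (rep s)).
    { unfold rle. rewrite (rep_vl s) by trivial. now apply Hs1, Hs. }
    apply (lin1 _ _ (rep x) (rsub (rep s) d) L). ring. }
  apply Hd, (lin1 _ _ d r0 K). ring.
Qed.

Lemma H_small d : pos d -> exists n, n ∈ om /\ rle (H n) d.
Proof.
  intros Hd. apply NNPP. intros N.
  assert (K : forall n, n ∈ om -> rle d (H n)).
  { intros n Hn. destruct (rle_total d (H n)); trivial. destruct N. eauto. }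
  (* The lower bounds of all powers are closed under adding [d]: such a bound, [d] and zero are each
     at most [H (succ n)], whose triple is [H n]. *)
  apply (no_bounded_shift (sep R (fun x => forall n, n ∈ om -> app le x (h n))) (H emp) d);
    trivial.
  - intros x Hx. rewrite mem_sep in Hx by defn. tauto.
  - exists (vl d). rewrite mem_sep by defn. split; [apply vl_in|]. intros n Hn.
    rewrite <- H_vl by trivial. now apply K.
  - intros a Ha. rewrite mem_sep in Ha by defn. unfold rle. rewrite H_vl by apply emp_om.
    apply Ha, emp_om.
  - intros a Ha. rewrite mem_sep in * by defn. split; [apply vl_in|]. intros n Hn.
    assert (Hs := succ_om n Hn). destruct Ha as [_ Ha]. specialize (Ha _ Hs).
    rewrite <- H_vl in * by trivial.
    change (rle (radd a d) (H n)). rewrite <- (H_S n Hn). unfold thr.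
    apply (lin3 _ _ _ _ _ _ _ _ Ha (K _ Hs) (pos_le _ (H_pos _ Hs))). ring.
Qed.

(** * The Archimedean property and the coding of sequences by sets of natural numbers *)

Definition nm (x i : V) : V := natrec zero (fun _ y => bin add y x) i.

Lemma dt_nm l (s t : env V l -> V) : dt s -> dt t -> dt (fun g => nm (s g) (t g)).
Proof. defu nm. Qed.
Hint Resolve dt_nm : defdb.

Definition NM a i : Rt := rep (nm (vl a) i).

Lemma nm_in a i : i ∈ om -> nm (vl a) i ∈ R.
Proof.
  revert i. apply nat_ind; [defn| |].
  - unfold nm. rewrite natrec_0 by defn. apply HR.
  - intros n Hn IH. unfold nm. rewrite natrec_S by (defn || trivial). fold (nm (vl a) n).
    rewrite <- (rep_vl _ IH). exact (vl_in (radd _ a)).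
Qed.

Lemma NM_vl a i : i ∈ om -> vl (NM a i) = nm (vl a) i.
Proof. intros Hi. now apply rep_vl, nm_in. Qed.

Lemma NM_0 a : NM a emp = r0.
Proof.
  apply vl_inj. rewrite NM_vl by apply emp_om. unfold nm. now rewrite natrec_0 by defn.
Qed.

Lemma NM_S a i : i ∈ om -> NM a (succ i) = radd (NM a i) a.
Proof.
  intros Hi. apply vl_inj. rewrite NM_vl by now apply succ_om. unfold nm.
  rewrite natrec_S by (defn || trivial). fold (nm (vl a) i). now rewrite <- NM_vl.
Qed.

Lemma archimedes d b : pos d -> exists i, i ∈ om /\ ~ rle (NM d i) b.
Proof.
  intros Hd. apply NNPP. intros N.
  assert (K : forall i, i ∈ om -> rle (NM d i) b).
  { intros i Hi. apply NNPP. intros L. apply N. eauto. }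
  apply (no_bounded_shift (repl om (nm (vl d))) b d); trivial.
  - intros x Hx. rewrite mem_repl in Hx by defn. destruct Hx as [i [Hi ->]]. now apply nm_in.
  - exists (nm (vl d) emp). rewrite mem_repl by defn. exists emp. auto using emp_om.
  - intros a Ha. rewrite mem_repl in Ha by defn. destruct Ha as [i [Hi E]].
    rewrite <- NM_vl in E by trivial. apply vl_inj in E. subst a. auto.
  - intros a Ha. rewrite mem_repl in * by defn. destruct Ha as [i [Hi E]].
    rewrite <- NM_vl in E by trivial. apply vl_inj in E. subst a.
    exists (succ i). split; [now apply succ_om|].
    rewrite <- NM_vl by now apply succ_om. now rewrite NM_S.
Qed.

(** Choose a mesh [H n] at most [b - a]; the first grid point above [a] cannot jump past [b]. A
    shift by [j] steps moves [a] to a positive number, so that multiples by natural numbers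
    suffice. *)
Lemma grid_separates a b : ~ rle b a -> exists i j n, i ∈ om /\ j ∈ om /\ n ∈ om /\
  rle (NM (H n) i) (radd b (NM (H n) j)) /\ ~ rle (NM (H n) i) (radd a (NM (H n) j)).
Proof.
  intros N.
  destruct (H_small (rsub b a)) as [n [Hn Hs]].
  { intros K. apply N. apply (lin1 _ _ _ _ K). ring. }
  destruct (archimedes (H n) (ropp a) (H_pos n Hn)) as [j [Hj Kj]].
  destruct (archimedes (H n) (radd a (NM (H n) j)) (H_pos n Hn)) as [i Hi].
  destruct (ord_least (fun i => i ∈ om /\
    ~ app le (nm (vl (H n)) i) (vl (radd a (NM (H n) j))))) as [k [_ [[Hk Nk] Mk]]].
  { defn. }
  { exists i. destruct Hi as [Hi Ni]. split; [now apply nat_ord|]. split; trivial.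
    now rewrite <- NM_vl. }
  rewrite <- NM_vl in Nk by trivial.
  exists k, j, n. split; [trivial|]. split; [trivial|]. split; [trivial|]. split; trivial.
  destruct (nat_case k Hk) as [->|[m [Hm ->]]].
  - destruct Nk. rewrite NM_0. destruct (rle_total (NM (H n) j) (ropp a)) as [K|K]; [tauto|].
    apply (lin1 _ _ _ _ K). ring.
  - rewrite NM_S by trivial.
    assert (L : rle (NM (H n) m) (radd a (NM (H n) j))).
    { apply NNPP. intros L. apply (Mk m (mem_succ_self m)). split; trivial.
      now rewrite <- NM_vl. }
    apply (lin2 _ _ _ _ _ _ Hs L). ring.
Qed.

(** The quadruple [k, i, j, n] is recorded when the grid point [(i - j) / 3^n] is at most the [k]-th
    term, so [enc x] lists the lower cuts of all terms. *)
Definition enc (x : V) : V := sep om (fun q => exists k i j n,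
  k ∈ om /\ i ∈ om /\ j ∈ om /\ n ∈ om /\ q = pr k (pr i (pr j n)) /\
  app le (nm (h n) i) (bin add (ap x k) (nm (h n) j))).

Lemma dt_enc l (s : env V l -> V) : dt s -> dt (fun g => enc (s g)).
Proof. defu enc. Qed.
Hint Resolve dt_enc : defdb.

Lemma enc_om x : enc x ∈ Pw om.
Proof.
  apply mem_Pw. intros q Hq. unfold enc in Hq. rewrite mem_sep in Hq by defn. tauto.
Qed.

Lemma mem_enc x k i j n : is_fun x om R -> k ∈ om -> i ∈ om -> j ∈ om -> n ∈ om ->
  pr k (pr i (pr j n)) ∈ enc x <->
  rle (NM (H n) i) (radd (rep (ap x k)) (NM (H n) j)).
Proof.
  intros Hx Hk Hi Hj Hn. unfold enc, rle, radd, vl at 2. simpl.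
  rewrite rep_vl by now apply (fun_in _ _ _ _ Hx). rewrite !NM_vl, !H_vl by trivial.
  rewrite mem_sep by defn. split.
  - intros [_ [k' [i' [j' [n' [Hk' [Hi' [Hj' [Hn' [E K]]]]]]]]]].
    assert (X := pr_om j n Hj Hn). assert (X' := pr_om j' n' Hj' Hn').
    assert (Y := pr_om _ _ Hi X). assert (Y' := pr_om _ _ Hi' X').
    destruct (pr_inj _ _ _ _ Hk Y Hk' Y' E) as [<- E1].
    destruct (pr_inj _ _ _ _ Hi X Hi' X' E1) as [<- E2].
    destruct (pr_inj _ _ _ _ Hj Hn Hj' Hn' E2) as [<- <-]. exact K.
  - intros K. split; [repeat apply pr_om; trivial|]. exists k, i, j, n. repeat split; trivial.
Qed.

(** If two terms differed, a grid point separating them would be recorded in only one of the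
    codes. *)
Lemma enc_inj x y : is_fun x om R -> is_fun y om R -> enc x = enc y -> x = y.
Proof.
  assert (K : forall x y k, is_fun x om R -> is_fun y om R -> enc x = enc y -> k ∈ om ->
    rle (rep (ap y k)) (rep (ap x k))).
  { clear x y. intros x y k Hx Hy E Hk. apply NNPP. intros N.
    destruct (grid_separates _ _ N) as [i [j [n [Hi [Hj [Hn [L1 L2]]]]]]].
    apply L2. apply (mem_enc x k i j n); trivial. rewrite E. now apply mem_enc. }
  intros Hx Hy E. apply (fun_ext x y om R R); trivial. intros k Hk.
  rewrite <- (rep_vl (ap x k)), <- (rep_vl (ap y k)) by
    first [now apply (fun_in _ _ _ _ Hx)|now apply (fun_in _ _ _ _ Hy)].
  f_equal. apply rle_antisym; [exact (K y x k Hy Hx (eq_sym E) Hk)|exact (K x y k Hx Hy E Hk)].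
Qed.

(** [emb A] is the sum of [3 ^ -n] over [n ∈ A]. *)
Definition psum (A n : V) : V := natrec zero (fun k x =>
  the (fun y => (k ∈ A /\ y = bin add x (h k)) \/ (k ∉ A /\ y = x))) n.
Definition emb (A : V) : V := the (fun s => s ∈ R /\
  (forall n, n ∈ om -> app le (psum A n) s) /\
  forall y, y ∈ R -> (forall n, n ∈ om -> app le (psum A n) y) -> app le s y).

Lemma dt_psum l (s t : env V l -> V) : dt s -> dt t -> dt (fun g => psum (s g) (t g)).
Proof. defu psum. Qed.
Hint Resolve dt_psum : defdb.
Lemma dt_emb l (s : env V l -> V) : dt s -> dt (fun g => emb (s g)).
Proof. defu emb. Qed.
Hint Resolve dt_emb : defdb.

Definition PS (A n : V) : Rt := rep (psum A n).

Lemma psum_step A n : n ∈ om -> (n ∈ A -> psum A (succ n) = bin add (psum A n) (h n)) /\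
  (n ∉ A -> psum A (succ n) = psum A n).
Proof.
  intros Hn. unfold psum. rewrite natrec_S by (defn || trivial).
  split; intros HA; apply the_eq; auto; intros y [[Hy E]|[Hy E]]; tauto.
Qed.

Lemma psum_in A n : n ∈ om -> psum A n ∈ R.
Proof.
  revert n. apply nat_ind; [defn| |].
  - unfold psum. rewrite natrec_0 by defn. apply HR.
  - intros n Hn IH. destruct (psum_step A n Hn) as [S1 S2].
    destruct (classic (n ∈ A)) as [HA|HA].
    + rewrite S1 by trivial. apply bin_in; [apply HR|trivial|now apply h_in].
    + now rewrite S2.
Qed.

Lemma PS_vl A n : n ∈ om -> vl (PS A n) = psum A n.
Proof. intros Hn. now apply rep_vl, psum_in. Qed.

Lemma PS_in A n : n ∈ om -> n ∈ A -> PS A (succ n) = radd (PS A n) (H n).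
Proof.
  intros Hn HA. apply vl_inj. rewrite PS_vl by now apply succ_om.
  rewrite (proj1 (psum_step A n Hn) HA). simpl. now rewrite PS_vl, H_vl.
Qed.

Lemma PS_notin A n : n ∈ om -> n ∉ A -> PS A (succ n) = PS A n.
Proof.
  intros Hn HA. apply vl_inj. rewrite PS_vl by now apply succ_om.
  rewrite (proj2 (psum_step A n Hn) HA). now rewrite PS_vl.
Qed.

Lemma PS_ext A B n : n ∈ om -> (forall k, k ∈ n -> k ∈ A <-> k ∈ B) -> PS A n = PS B n.
Proof.
  intros Hn K. unfold PS. apply (f_equal rep). revert n Hn K.
  apply (nat_ind (fun n => (forall k, k ∈ n -> k ∈ A <-> k ∈ B) -> psum A n = psum B n)); [defn| |].
  - intros _. unfold psum. now rewrite !natrec_0 by defn.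
  - intros n Hn IH K. assert (E : psum A n = psum B n).
    { apply IH. intros k Hk. apply K, mem_succ. auto. }
    destruct (psum_step A n Hn) as [A1 A2], (psum_step B n Hn) as [B1 B2].
    assert (L := K n (mem_succ_self n)).
    destruct (classic (n ∈ A)) as [HA|HA].
    + rewrite A1, B1 by tauto. now rewrite E.
    + rewrite A2, B2 by tauto. exact E.
Qed.

(** All terms from stage [n] on add up to at most 3/2 times [H n]. Hence partial sums increase,
    while partial sums plus twice the current power decrease. The hypothesis [n ∈ succ m] says that
    [n] is at most [m]. *)
Lemma PS_bounds A n m : n ∈ om -> m ∈ om -> n ∈ succ m ->
  rle (PS A n) (PS A m) /\
  rle (radd (PS A m) (radd (H m) (H m))) (radd (PS A n) (radd (H n) (H n))).
Proof.
  intros Hn Hm Hnm.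
  assert (K : app le (psum A n) (psum A m) /\
    app le (bin add (psum A m) (bin add (h m) (h m))) (bin add (psum A n) (bin add (h n) (h n)))).
  2:{ rewrite <- !PS_vl, <- !H_vl in K by trivial. exact K. }
  revert m Hm Hnm. apply (nat_ind (fun m => n ∈ succ m ->
    app le (psum A n) (psum A m) /\
    app le (bin add (psum A m) (bin add (h m) (h m))) (bin add (psum A n) (bin add (h n) (h n)))));
    [defn| |].
  - intros H0. apply mem_succ in H0. destruct H0 as [H0|H0]; [destruct (mem_emp _ H0)|subst n].
    rewrite <- !PS_vl, <- !H_vl by trivial.
    exact (conj (rle_refl _) (rle_refl (radd (PS A emp) (radd (H emp) (H emp))))).
  - intros m Hm IH H0. apply mem_succ in H0. destruct H0 as [H0|H0].
    2:{ subst n. rewrite <- !PS_vl, <- !H_vl by trivial.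
        exact (conj (rle_refl _)
          (rle_refl (radd (PS A (succ m)) (radd (H (succ m)) (H (succ m)))))). }
    specialize (IH H0). assert (Hs := succ_om m Hm).
    rewrite <- !PS_vl, <- !H_vl in * by trivial.
    change (rle (PS A n) (PS A m) /\
      rle (radd (PS A m) (radd (H m) (H m))) (radd (PS A n) (radd (H n) (H n)))) in IH.
    change (rle (PS A n) (PS A (succ m)) /\
      rle (radd (PS A (succ m)) (radd (H (succ m)) (H (succ m)))) (radd (PS A n) (radd (H n) (H n)))).
    destruct IH as [I1 I2]. assert (P1 := pos_le _ (H_pos _ Hm)).
    assert (P2 := pos_le _ (H_pos _ Hs)). assert (E := H_S m Hm). unfold thr in E.
    destruct (classic (m ∈ A)) as [HA|HA].
    + rewrite PS_in by trivial. split.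
      * apply (lin2 _ _ _ _ _ _ I1 P1). ring.
      * apply (lin2 _ _ _ _ _ _ I2 P2). rewrite <- E. ring.
    + rewrite PS_notin by trivial. split; [exact I1|].
      assert (P4 : rle r0 (radd (radd (H (succ m)) (H (succ m))) (radd (H (succ m)) (H (succ m)))))
        by exact (nn_add _ _ (nn_add _ _ P2 P2) (nn_add _ _ P2 P2)).
      apply (lin2 _ _ _ _ _ _ I2 P4). rewrite <- E. ring.
Qed.

Lemma emb_spec A : emb A ∈ R /\
  (forall n, n ∈ om -> rle (PS A n) (rep (emb A))) /\
  (forall n, n ∈ om -> rle (rep (emb A)) (radd (PS A n) (radd (H n) (H n)))).
Proof.
  (* Every partial sum lies below every one of these upper ends, so each of them bounds the
     supremum. *)
  assert (U : forall n m, n ∈ om -> m ∈ om -> rle (PS A m) (radd (PS A n) (radd (H n) (H n)))).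
  { intros n m Hn Hm.
    assert (C : n ∈ succ m \/ m ∈ succ n).
    { destruct (ord_tri n m) as [C|[->|C]]; try now apply nat_ord.
      - left. apply mem_succ. auto.
      - left. apply mem_succ_self.
      - right. apply mem_succ. auto. }
    assert (Pn := pos_le _ (H_pos n Hn)). assert (Pm := pos_le _ (H_pos m Hm)).
    destruct C as [C|C].
    - destruct (PS_bounds A n m Hn Hm C) as [_ L].
      apply (lin3 _ _ _ _ _ _ _ _ L Pm Pm). ring.
    - destruct (PS_bounds A m n Hm Hn C) as [L _].
      apply (lin3 _ _ _ _ _ _ _ _ L Pn Pn). ring. }
  assert (K : emb A ∈ R /\ (forall n, n ∈ om -> app le (psum A n) (emb A)) /\
   forall y, y ∈ R -> (forall n, n ∈ om -> app le (psum A n) y) -> app le (emb A) y).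
  { apply (theP (fun s => s ∈ R /\ (forall n, n ∈ om -> app le (psum A n) s) /\
     forall y, y ∈ R -> (forall n, n ∈ om -> app le (psum A n) y) -> app le s y)).
    - destruct (cof_sup _ _ _ _ _ _ HR (repl om (psum A))) as [s [[Rs S1] S2]].
      + intros x Hx. rewrite mem_repl in Hx by defn. destruct Hx as [n [Hn ->]].
        now apply psum_in.
      + exists (psum A emp). rewrite mem_repl by defn. exists emp. auto using emp_om.
      + exists (vl (radd (PS A emp) (radd (H emp) (H emp)))). split; [apply vl_in|].
        intros x Hx. rewrite mem_repl in Hx by defn. destruct Hx as [n [Hn ->]].
        rewrite <- PS_vl by trivial. apply U; trivial using emp_om.
      + exists s. split; [trivial|]. split.
        * intros n Hn. apply S1. rewrite mem_repl by defn. eauto.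
        * intros y Ry Hy. apply S2. split; trivial. intros x Hx.
          rewrite mem_repl in Hx by defn. destruct Hx as [n [Hn ->]]. auto.
    - intros s t [Rs [S1 S2]] [Ts [T1 T2]]. apply (cof_le_antisym _ _ _ _ _ _ HR); auto. }
  destruct K as [K1 [K2 K3]]. split; [trivial|]. unfold rle. rewrite rep_vl by trivial. split.
  - intros n Hn. rewrite PS_vl by trivial. auto.
  - intros n Hn. apply K3; [apply vl_in|]. intros m Hm. rewrite <- PS_vl by trivial.
    now apply U.
Qed.

(** At the first difference [n], the set containing [n] gains [H n], three times the next power,
    while the remaining terms of the other set contribute at most twice that power. *)
Lemma emb_inj A B : A ∈ Pw om -> B ∈ Pw om -> emb A = emb B -> A = B.
Proof.
  intros HA HB E. apply NNPP. intros N. apply mem_Pw in HA. apply mem_Pw in HB.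
  destruct (ord_least (fun n => n ∈ om /\ ~ (n ∈ A <-> n ∈ B))) as [n [_ [[Hn D] M]]].
  { defn. }
  { apply NNPP. intros L. apply N, ext. intros z. apply NNPP. intros D. apply L. exists z.
    assert (Hz : z ∈ om).
    { apply NNPP. intros Hz. apply D. split; intros K; destruct Hz; auto. }
    split; [now apply nat_ord|split; trivial]. }
  assert (X : forall k, k ∈ n -> k ∈ A <-> k ∈ B).
  { intros k Hk. apply NNPP. intros K. apply (M k Hk). split; trivial.
    now apply (om_trans k n). }
  assert (K : forall A B, n ∈ A -> n ∉ B -> emb A = emb B -> PS A n = PS B n -> False).
  { clear - HR Hn. intros A B HA HB E EP. assert (Hs := succ_om n Hn).
    destruct (emb_spec A) as [_ [L1 _]]. destruct (emb_spec B) as [_ [_ L2]].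
    specialize (L1 _ Hs). specialize (L2 _ Hs). rewrite E in L1.
    rewrite PS_in in L1 by trivial. rewrite PS_notin in L2 by trivial.
    rewrite EP in L1. assert (EH := H_S n Hn). unfold thr in EH.
    apply (H_pos _ Hs). apply (lin2 _ _ _ _ _ _ L1 L2). rewrite <- EH. ring. }
  assert (EP := PS_ext A B n Hn X).
  destruct (classic (n ∈ A)) as [H1|H1], (classic (n ∈ B)) as [H2|H2]; try tauto.
  - exact (K A B H1 H2 E EP).
  - exact (K B A H2 H1 (eq_sym E) (eq_sym EP)).
Qed.

End Reals.

(** [J] codes a sequence as a set of natural numbers and then applies the embedding [E]. Both
    operations are definable and take values in [R] on every argument. *)
Lemma reals_coding {V : set_structure} {hV : ZF V} (R : V) : is_reals R ->
  exists E J : V -> V, op E /\ op J /\ (forall A, E A ∈ R) /\ (forall x, J x ∈ R) /\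
    (forall A B, A ∈ Pw om -> B ∈ Pw om -> E A = E B -> A = B) /\
    (forall x y, is_fun x om R -> is_fun y om R -> J x = J y -> x = y).
Proof.
  intros [add [mul [le [zero [one HR]]]]].
  exists (@emb V hV R add le zero one),
    (fun x => @emb V hV R add le zero one (@enc V hV R add le zero one x)).
  assert (D := @dt_emb V hV R add le zero one). assert (D' := @dt_enc V hV R add le zero one).
  split; [unfold op; auto with defdb|]. split; [unfold op; auto with defdb|].
  split; [intros A; apply (emb_spec HR)|]. split; [intros x; apply (emb_spec HR)|].
  split; [apply (emb_inj HR)|].
  intros x y Hx Hy E. apply (enc_inj HR x y Hx Hy), (emb_inj HR); trivial; apply enc_om.
Qed.

(** * Enumerations in type [omega_1] *)
Section Enumeration.
Context {V : set_structure} {hV : ZF V}.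

(** Pick repeatedly from what is left. Elements could be left forever only if the ordinals injected
    into [X], so the remainder is exhausted at a least ordinal [th]. *)
Lemma enumerate (X : V) (pick : V -> V) : op pick ->
  (forall Y, subset Y X -> (exists y, y ∈ Y) -> pick Y ∈ Y) ->
  exists F th, op F /\ is_ordinal th /\ (forall a, a ∈ th -> F a ∈ X) /\
    (forall a b, a ∈ th -> b ∈ th -> F a = F b -> a = b) /\
    (forall x, x ∈ X -> exists a, a ∈ th /\ F a = x) /\
    (forall a, a ∈ th -> F a = pick (sep X (fun x => forall b, b ∈ a -> x <> F b))).
Proof.
  intros Hp HY.
  set (G := fun a f => pick (sep X (fun x => forall b, b ∈ a -> x <> ap f b))).
  assert (HG : op2 G) by (unfold G; defn).
  set (F := rec G). assert (HF : op F) by (unfold F, G; defn).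
  set (rest := fun a => sep X (fun x => forall b, b ∈ a -> x <> F b)).
  assert (mem_rest : forall a x, x ∈ rest a <-> x ∈ X /\ forall b, b ∈ a -> x <> F b).
  { intros a x. unfold rest. apply mem_sep. defn. }
  assert (HFa : forall a, is_ordinal a -> F a = pick (rest a)).
  { intros a Ha. unfold F at 1. rewrite rec_eq by trivial. unfold G at 1. f_equal.
    apply ext. intros x. rewrite mem_rest, mem_sep by defn.
    split; intros [Hx H]; split; trivial; intros b Hb; specialize (H b Hb);
    rewrite ap_lam in * by trivial; exact H. }
  assert (Hin : forall a, is_ordinal a -> (exists x, x ∈ rest a) -> F a ∈ rest a).
  { intros a Ha H. rewrite HFa by trivial. apply HY; trivial.
    intros x Hx. now apply mem_rest in Hx. }
  assert (Hinj : forall a b, is_ordinal a -> is_ordinal b -> a ∈ b ->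
    (exists x, x ∈ rest b) -> F a <> F b).
  { intros a b Ha Hb Hab H E. specialize (Hin b Hb H). apply mem_rest in Hin.
    apply (proj2 Hin a Hab). now symmetry. }
  destruct (ord_least (fun a => ~ exists x, x ∈ rest a)) as [th [Hth [Nth Mth]]].
  { unfold rest. defn. }
  { apply NNPP. intros N.
    assert (K : forall a, is_ordinal a -> exists x, x ∈ rest a).
    { intros a Ha. apply NNPP. intros L. apply N. eauto. }
    apply (no_ord_inj X F HF).
    - intros a Ha. apply (mem_rest a), Hin; auto.
    - intros a b Ha Hb E. destruct (ord_tri a b Ha Hb) as [H|[H|H]]; trivial.
      + destruct (Hinj a b Ha Hb H (K b Hb) E).
      + symmetry in E. destruct (Hinj b a Hb Ha H (K a Ha) E). }
  assert (K : forall a, a ∈ th -> is_ordinal a /\ exists x, x ∈ rest a).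
  { intros a Ha. split; [now apply (ord_mem th)|]. apply NNPP. exact (Mth a Ha). }
  exists F, th. split; [exact HF|]. split; [exact Hth|]. split; [|split; [|split]].
  - intros a Ha. apply (mem_rest a), Hin; now apply K.
  - intros a b Ha Hb E. destruct (K a Ha) as [Oa Ra], (K b Hb) as [Ob Rb].
    destruct (ord_tri a b Oa Ob) as [H|[H|H]]; trivial.
    + destruct (Hinj a b Oa Ob H Rb E).
    + symmetry in E. destruct (Hinj b a Ob Oa H Ra E).
  - intros x Hx. apply NNPP. intros N. apply Nth. exists x. apply mem_rest. split; trivial.
    intros b Hb E. apply N. exists b. auto.
  - intros a Ha. apply HFa. now apply K.
Qed.

(** [(B x, A x, N x)] is an injective key such that only countably many keys have first
    component at most a given element of [o]. *)
Lemma omega1_enumeration (X o : V) (B A N s : V -> V) : op B -> op A -> op N -> op s ->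
  is_omega1 o ->
  (forall x, x ∈ X -> B x ∈ o /\ A x ∈ B x /\ N x ∈ om) ->
  (forall x y, x ∈ X -> y ∈ X -> B x = B y -> A x = A y -> N x = N y -> x = y) ->
  (forall a, a ∈ o -> s a ∈ X) ->
  (forall a b, a ∈ o -> b ∈ o -> s a = s b -> a = b) ->
  exists t, omega1_injection t X /\ onto t X.
Proof.
  intros DB DA DN Ds [Oo [No Co]] Hk Hinj Hs1 Hs2.
  (* The next element is the one with the lexicographically least key; injectivity of the key makes
     it unique, so a description names it. *)
  set (b0 := fun Y => least (fun b => exists x, x ∈ Y /\ B x = b)).
  set (a0 := fun Y => least (fun a => exists x, x ∈ Y /\ B x = b0 Y /\ A x = a)).
  set (n0 := fun Y => least (fun n => exists x, x ∈ Y /\ B x = b0 Y /\ A x = a0 Y /\ N x = n)).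
  set (pick := fun Y => the (fun x => x ∈ Y /\ B x = b0 Y /\ A x = a0 Y /\ N x = n0 Y)).
  assert (OB : forall x, x ∈ X -> is_ordinal (B x)).
  { intros x Hx. apply (ord_mem o); trivial. now apply Hk. }
  assert (OA : forall x, x ∈ X -> is_ordinal (A x)).
  { intros x Hx. apply (ord_mem (B x)); auto. now apply Hk. }
  assert (ON : forall x, x ∈ X -> is_ordinal (N x)).
  { intros x Hx. apply nat_ord. now apply Hk. }
  assert (P : forall Y, subset Y X -> (exists y, y ∈ Y) ->
    pick Y ∈ Y /\ forall y, y ∈ Y -> B y ∉ B (pick Y)).
  { intros Y HY [y Hy].
    destruct (least_spec (fun b => exists x, x ∈ Y /\ B x = b)) as [_ [[x1 [X1 E1]] M]].
    { defn. } { exists (B y). split; [auto|]. exists y. auto. }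
    fold (b0 Y) in E1, M.
    destruct (least_spec (fun a => exists x, x ∈ Y /\ B x = b0 Y /\ A x = a))
      as [_ [[x2 [X2 [E2 E2']]] _]].
    { defn. } { exists (A x1). split; [auto|]. exists x1. auto. }
    fold (a0 Y) in E2'.
    destruct (least_spec (fun n => exists x, x ∈ Y /\ B x = b0 Y /\ A x = a0 Y /\ N x = n))
      as [_ [[x3 [X3 [E3 [E3' E3'']]]] _]].
    { defn. } { exists (N x2). split; [auto|]. exists x2. auto. }
    fold (n0 Y) in E3''.
    assert (Q : pick Y ∈ Y /\ B (pick Y) = b0 Y /\ A (pick Y) = a0 Y /\ N (pick Y) = n0 Y).
    { apply (theP (fun x => x ∈ Y /\ B x = b0 Y /\ A x = a0 Y /\ N x = n0 Y)).
      - exists x3. auto.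
      - intros u v [U1 [U2 [U3 U4]]] [V1 [V2 [V3 V4]]]. apply Hinj; auto; congruence. }
    split; [apply Q|]. intros z Hz Hlt. destruct Q as [_ [Q _]]. rewrite Q in Hlt.
    apply (M _ Hlt). eauto. }
  destruct (enumerate X pick) as [F [th [DF [Oth [F1 [F2 [F3 F4]]]]]]].
  { unfold pick, n0, a0, b0. defn. }
  { intros Y HY NY. now apply P. }
  exists (lam th F).
  assert (HF : is_fun (lam th F) th X) by now apply is_fun_lam.
  split.
  2:{ intros x Hx. destruct (F3 x Hx) as [a [Ha <-]]. exists a. now apply app_lam. }
  exists th. split; [|split; [exact HF|]].
  2:{ apply (injectiveP _ _ _ HF). intros a b Ha Hb. rewrite !ap_lam by trivial. auto. }
  split; [exact Oth|]. split.
  (* If [th] were countable then so would be [o], by sending [a] to the position of [s a]. *)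
  - intros C. apply No.
    assert (Q : forall a, a ∈ o -> the (fun b => b ∈ th /\ F b = s a) ∈ th /\
       F (the (fun b => b ∈ th /\ F b = s a)) = s a).
    { intros a Ha. apply (theP (fun b => b ∈ th /\ F b = s a)).
      - apply F3. auto.
      - intros u v [U1 U2] [V1 V2]. apply F2; congruence. }
    apply (countable_inj o th (fun a => the (fun b => b ∈ th /\ F b = s a))); trivial.
    + defn.
    + intros a Ha. now apply Q.
    + intros a b Ha Hb E. apply Hs2; trivial.
      destruct (Q a Ha) as [_ <-], (Q b Hb) as [_ <-]. now rewrite E.
  - intros a Ha.
    assert (Cb : countable (succ (B (F a)))).
    { apply countable_succ, Co, Hk. auto. }
    destruct (countable_elim _ Cb) as [g [G1 G2]].
    assert (Osb := ord_succ _ (OB _ (F1 a Ha))).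
    (* When [F b] was picked, [F a] was still available, so the first component of the key of [F b]
       is at most that of [F a]. The positions below [a] therefore use only countably many keys. *)
    assert (L : forall b, b ∈ a -> F b ∈ X /\ b ∈ th /\
      B (F b) ∈ succ (B (F a)) /\ A (F b) ∈ succ (B (F a))).
    { intros b Hb. assert (Hbt : b ∈ th) by now apply (ord_trans b a).
      assert (HX := F1 b Hbt). split; [trivial|]. split; [trivial|].
      assert (L : B (F b) ∈ succ (B (F a))).
      { destruct (P (sep X (fun x => forall d, d ∈ b -> x <> F d))) as [_ M].
        - intros x Hx. rewrite mem_sep in Hx by defn. tauto.
        - exists (F b). rewrite mem_sep by defn. split; trivial.
          intros d Hd E. apply F2 in E; trivial; [|now apply (ord_trans d b)].
          subst d. exact (mem_irrefl _ Hd).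
        - rewrite <- F4 in M by trivial. specialize (M (F a)).
          apply mem_succ. destruct (ord_tri (B (F b)) (B (F a))) as [T|[T|T]]; auto.
          destruct M; trivial. rewrite mem_sep by defn. split; [auto|].
          intros d Hd E. assert (Hda : d ∈ a) by (apply (ord_trans d b); trivial; now apply (ord_mem th)).
          apply F2 in E; trivial; [|now apply (ord_trans d a)].
          subst d. exact (mem_irrefl _ Hda). }
      split; [exact L|]. apply (ord_trans _ (B (F b))); trivial. now apply Hk. }
    apply (countable_intro a
      (fun b => pr (ap g (B (F b))) (pr (ap g (A (F b))) (N (F b))))).
    + defn.
    + intros b Hb. destruct (L b Hb) as [L1 [L2 [L3 L4]]].
      apply pr_om; [now apply G1|]. apply pr_om; [now apply G1|]. now apply Hk.
    + intros b d Hb Hd E. destruct (L b Hb) as [L1 [L2 [L3 L4]]].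
      destruct (L d Hd) as [M1 [M2 [M3 M4]]].
      assert (Nb := proj2 (proj2 (Hk _ L1))). assert (Nd := proj2 (proj2 (Hk _ M1))).
      destruct (pr_inj _ _ _ _ (G1 _ L3) (pr_om _ _ (G1 _ L4) Nb) (G1 _ M3)
        (pr_om _ _ (G1 _ M4) Nd) E) as [E1 E2].
      destruct (pr_inj _ _ _ _ (G1 _ L4) Nb (G1 _ M4) Nd E2) as [E3 E4].
      apply F2; trivial. apply Hinj; auto.
Qed.

(** * Colourings of the plane and the enumeration of the reals *)

Definition proper_coloring (R c : V) : Prop :=
  (forall x y, x ∈ R -> y ∈ R -> ap c (opair x y) ∈ om) /\
  (forall x x' y y', x ∈ R -> x' ∈ R -> y ∈ R -> y' ∈ R -> y <> y' ->
     ap c (opair x y) = ap c (opair x y') -> ap c (opair x' y) = ap c (opair x' y') ->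
     ap c (opair x y) = ap c (opair x' y) -> x = x').

(** If [x] and [x'] were distinct, the four equal colours would make [{x, x'}] times [{y, y'}] a
    monochromatic rectangle. *)
Lemma proper_coloring_exists (R : V) : Gamma_countably_chromatic R -> exists c, proper_coloring R c.
Proof.
  intros [R2 [H2 [w [c [Hw [Hc Hm]]]]]]. apply is_prodP in H2. apply is_omegaP in Hw.
  subst R2 w. exists c.
  assert (C : forall x y, x ∈ R -> y ∈ R -> opair x y ∈ prod R R).
  { intros x y Hx Hy. apply mem_prod. eauto. }
  split.
  - intros x y Hx Hy. apply (fun_in _ _ _ _ Hc). auto.
  - intros x x' y y' Hx Hx' Hy Hy' Ny E1 E2 E3. apply NNPP. intros Nx.
    apply (Hm (prod (upair x x') (upair y y'))).
    + exists (upair x x'), (upair y y'). split; [|split; [|split; [|split]]].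
      * intros z Hz. apply mem_upair in Hz. now destruct Hz as [-> | ->].
      * exists x, x'. now rewrite is_upairP.
      * intros z Hz. apply mem_upair in Hz. now destruct Hz as [-> | ->].
      * exists y, y'. now rewrite is_upairP.
      * now apply is_prodP.
    + exists (ap c (opair x y)). intros p Hp. apply mem_prod in Hp.
      destruct Hp as [u [v [Hu [Hv ->]]]]. apply mem_upair in Hu. apply mem_upair in Hv.
      apply (app_fun _ _ _ _ _ Hc).
      destruct Hu as [-> | ->], Hv as [-> | ->]; split; auto; congruence.
Qed.

(** For every real [x] two points of the [omega_1]-sequence get the same colour in row [x],
    and the two points together with the colour determine [x]. *)
Lemma reals_omega1 (R : V) : Gamma_countably_chromatic R -> (exists s, omega1_injection s R) ->
  exists s, omega1_injection s R /\ onto s R.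
Proof.
  intros HR [s [o [Ho [Hs Hi]]]]. destruct (proper_coloring_exists R HR) as [c [C1 C2]].
  assert (Oo := proj1 Ho). rewrite (injectiveP _ _ _ Hs) in Hi.
  assert (Hin : forall a, a ∈ o -> ap s a ∈ R) by (intros a; now apply fun_in).
  set (B := fun x => least (fun b => b ∈ o /\ exists a, a ∈ b /\
    ap c (opair x (ap s a)) = ap c (opair x (ap s b)))).
  set (A := fun x => least (fun a => a ∈ B x /\
    ap c (opair x (ap s a)) = ap c (opair x (ap s (B x))))).
  assert (DB : op B) by (unfold B; defn). assert (DA : op A) by (unfold A; defn).
  assert (K : forall x, x ∈ R -> B x ∈ o /\ A x ∈ B x /\
    ap c (opair x (ap s (A x))) = ap c (opair x (ap s (B x)))).
  { intros x Hx.
    destruct (least_spec (fun b => b ∈ o /\ exists a, a ∈ b /\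
      ap c (opair x (ap s a)) = ap c (opair x (ap s b)))) as [OB [[HB [a [Ha E]]] _]].
    - defn.
    (* Without a repetition the colours in row [x] along the sequence would inject [o] into the
       natural numbers. *)
    - apply NNPP. intros N. apply (proj1 (proj2 Ho)).
      apply (countable_intro o (fun a => ap c (opair x (ap s a)))).
      + defn.
      + auto.
      + intros a b Ha Hb E.
        assert (Oa := ord_mem o a Oo Ha). assert (Ob := ord_mem o b Oo Hb).
        destruct (ord_tri a b Oa Ob) as [H|[H|H]]; trivial; destruct N.
        * exists b. split; [exact Ob|]. split; [exact Hb|]. exists a. split; [exact H|exact E].
        * exists a. split; [exact Oa|]. split; [exact Ha|]. exists b. split; [exact H|exact (eq_sym E)].
    - fold (B x) in OB, HB, Ha, E. split; [exact HB|].
      destruct (least_spec (fun a => a ∈ B x /\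
        ap c (opair x (ap s a)) = ap c (opair x (ap s (B x))))) as [_ [Q _]].
      + defn.
      + exists a. split; [exact (ord_mem (B x) a OB Ha)|]. split; [exact Ha|exact E].
      + exact Q. }
  (* The key of [x] is the place of the first repetition, the earlier place and the common
     colour. *)
  apply (omega1_enumeration R o B A (fun x => ap c (opair x (ap s (B x)))) (ap s));
    trivial; try defn.
  - intros x Hx. destruct (K x Hx) as [K1 [K2 _]]. auto.
  - intros x y Hx Hy EB EA EN. destruct (K x Hx) as [X1 [X2 X3]].
    destruct (K y Hy) as [Y1 [Y2 Y3]].
    assert (HA : A x ∈ o) by now apply (ord_trans _ (B x)).
    rewrite <- EA, <- EB in Y3. rewrite <- X3, <- EB, <- Y3 in EN.
    refine (C2 x y (ap s (A x)) (ap s (B x)) Hx Hy (Hin _ HA) (Hin _ X1) _ X3 Y3 EN).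
    intros E. apply Hi in E; [|exact HA|exact X1]. rewrite E in X2. exact (mem_irrefl _ X2).
Qed.
End Enumeration.
(** * Sections of [E1] *)
Section Sections.
Context {V : set_structure} {hV : ZF V}.

Lemma E1_refl (R x : V) : is_fun x om R -> E1 R x x.
Proof.
  intros H. apply E1P. split; [trivial|]. split; [trivial|]. exists emp. auto using emp_om.
Qed.

Lemma E1_sym (R x y : V) : E1 R x y -> E1 R y x.
Proof.
  rewrite !E1P. intros [Hx [Hy [m [Hm H]]]]. split; [trivial|]. split; [trivial|].
  exists m. split; trivial. intros n Hn Nn. symmetry. auto.
Qed.

Lemma nat_max m k : m ∈ om -> k ∈ om -> exists l, l ∈ om /\
  forall n, n ∈ l <-> n ∈ m \/ n ∈ k.
Proof.
  intros Hm Hk. destruct (ord_tri m k) as [H|[<-|H]]; try now apply nat_ord.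
  - exists k. split; trivial. intros n. split; [tauto|]. intros [Hn|Hn]; trivial.
    apply (ord_trans n m k); trivial. now apply nat_ord.
  - exists m. split; trivial. intros n. tauto.
  - exists m. split; trivial. intros n. split; [tauto|]. intros [Hn|Hn]; trivial.
    apply (ord_trans n k m); trivial. now apply nat_ord.
Qed.

Lemma E1_trans (R x y z : V) : E1 R x y -> E1 R y z -> E1 R x z.
Proof.
  rewrite !E1P. intros [Hx [Hy [m [Hm H]]]] [_ [Hz [k [Hk K]]]].
  split; [trivial|]. split; [trivial|].
  destruct (nat_max m k Hm Hk) as [l [Hl L]]. exists l. split; trivial.
  intros n Hn Nn. rewrite L in Nn. transitivity (ap y n); [apply H|apply K]; tauto.
Qed.

Lemma def_E1 l (r s t : env V l -> V) : dt r -> dt s -> dt t ->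
  def (fun g => E1 (r g) (s g) (t g)).
Proof.
  intros Hr Hs Ht. apply (def_iff_def l _ _ (fun g => E1P (r g) (s g) (t g))). defn.
Qed.
Hint Resolve def_E1 : defdb.

(** The section consists of the elements of minimal rank in their classes. *)
Lemma section_of_rank (R : V) (rk : V -> V) : op rk ->
  (forall x, is_fun x om R -> is_ordinal (rk x)) ->
  (forall x, is_fun x om R -> (forall y, E1 R x y -> rk y ∉ rk x) ->
     exists I, countable I /\ forall y, E1 R x y -> (forall z, E1 R y z -> rk z ∉ rk y) -> y ∈ I) ->
  exists S, complete_countable_section R S.
Proof.
  intros Drk Ork HI.
  set (S := sep (Pw (prod om R)) (fun x => is_fun x om R /\ forall y, E1 R x y -> rk y ∉ rk x)).
  assert (HS : forall x, x ∈ S <-> is_fun x om R /\ forall y, E1 R x y -> rk y ∉ rk x).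
  { intros x. unfold S. rewrite mem_sep by defn. split; [tauto|]. intros H. split; trivial.
    apply mem_Pw. intros p Hp. apply mem_prod. destruct H as [[H _] _].
    destruct (H p Hp) as [u [v [Hu [Hv E]]]]. apply is_opairP in E. eauto. }
  exists S. split.
  { intros x Hx. apply is_seqP. now apply HS. }
  intros x Hx. apply is_seqP in Hx. exists (sep S (fun y => E1 R x y)).
  assert (HIx : forall y, y ∈ sep S (fun y => E1 R x y) <-> y ∈ S /\ E1 R x y).
  { intros y. apply mem_sep. defn. }
  assert (NE : exists y, y ∈ sep S (fun y => E1 R x y)).
  (* An element attaining the least rank in the class of [x] is minimal in its own class, by
     transitivity, so it lies in [S]. *)
  { destruct (ord_least (fun a => exists y, E1 R x y /\ rk y = a)) as [a [_ [[y [Hy Ea]] Ma]]].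
    - defn.
    - exists (rk x). split; [auto|]. exists x. auto using E1_refl.
    - subst a. exists y. apply HIx. split; [|exact Hy]. apply HS.
      split; [now apply E1P in Hy|]. intros z Hz Hlt. apply (Ma _ Hlt). exists z.
      split; [exact (E1_trans R x y z Hy Hz)|reflexivity]. }
  split; [exact HIx|]. split; [exact NE|].
  destruct NE as [y Hy]. apply HIx in Hy. destruct Hy as [Hy Exy].
  apply HS in Hy. destruct (HI y (proj1 Hy) (proj2 Hy)) as [I [CI K]].
  apply (countable_inj _ I (fun z => z)); trivial; [defn|].
  intros z Hz. apply HIx in Hz. destruct Hz as [Hz Exz]. apply K.
  - exact (E1_trans R y x z (E1_sym R x y Exy) Exz).
  - now apply HS.
Qed.

Lemma countable_singleton (x : V) : countable (upair x x).
Proof.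
  apply (countable_intro _ (fun _ => emp)).
  - defn.
  - intros y _. apply emp_om.
  - intros y z Hy Hz _. apply mem_upair in Hy. apply mem_upair in Hz. intuition congruence.
Qed.

(** The enumeration composed with [J] ranks sequences injectively, so each class has exactly one
    element of least rank. *)
Lemma section_of_enumeration (R s : V) (J : V -> V) : op J -> (forall x, J x ∈ R) ->
  (forall x y, is_fun x om R -> is_fun y om R -> J x = J y -> x = y) ->
  omega1_injection s R -> onto s R -> exists S, complete_countable_section R S.
Proof.
  intros DJ J1 J2 [o [[Oo _] [Hs Hi]]] Hon.
  rewrite (injectiveP _ _ _ Hs) in Hi.
  set (key := fun x => the (fun a => a ∈ o /\ ap s a = J x)).
  assert (Dk : op key) by (unfold key; defn).
  assert (K : forall x, key x ∈ o /\ ap s (key x) = J x).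
  { intros x. apply (theP (fun a => a ∈ o /\ ap s a = J x)).
    - destruct (Hon (J x) (J1 x)) as [a Ha]. apply (app_fun _ _ _ _ _ Hs) in Ha.
      exists a. intuition.
    - intros a b [Ha Ea] [Hb Eb]. apply Hi; trivial. congruence. }
  assert (Ok : forall x, is_ordinal (key x)).
  { intros x. apply (ord_mem o); trivial. apply K. }
  apply (section_of_rank R key); auto.
  intros x Hx Mx. exists (upair x x). split; [apply countable_singleton|].
  intros y Hy My. apply mem_upair. left.
  assert (Hyf : is_fun y om R) by now apply E1P in Hy.
  apply J2; trivial. destruct (K x) as [_ <-], (K y) as [_ <-].
  destruct (ord_tri (key x) (key y) (Ok x) (Ok y)) as [T|[T|T]].
  - destruct (My x (E1_sym R x y Hy) T).
  - now rewrite T.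
  - destruct (Mx y Hy T).
Qed.

(** The orders of [a] and [b], transported by [F] and [G], are the same relation. Reflexive pairs
    are included so that even a one-point order leaves a trace. *)
Definition same_order (a b : V) (F G : V -> V) : Prop := forall i j,
  (exists x y, x ∈ a /\ y ∈ a /\ (x ∈ y \/ x = y) /\ i = F x /\ j = F y) <->
  (exists x y, x ∈ b /\ y ∈ b /\ (x ∈ y \/ x = y) /\ i = G x /\ j = G y).

(** Isomorphic ordinals are equal: by induction, [x] and the point of [b] with the same image have
    the same elements. *)
Lemma coded_order_subset (a b : V) (F G : V -> V) : op F -> op G ->
  is_ordinal a -> is_ordinal b ->
  (forall x y, x ∈ a -> y ∈ a -> F x = F y -> x = y) ->
  (forall x y, x ∈ b -> y ∈ b -> G x = G y -> x = y) ->
  same_order a b F G -> subset a b.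
Proof.
  intros DF DG Oa Ob IF IG E.
  assert (K : forall x, is_ordinal x -> x ∈ a -> x ∈ b /\ G x = F x).
  { apply (ord_ind (fun x => x ∈ a -> x ∈ b /\ G x = F x)); [defn|].
    intros x Ox IH Hx.
    assert (L : exists x', x' ∈ b /\ F x = G x').
    { destruct (proj1 (E (F x) (F x))) as [u [v [Hu [_ [_ [Eu _]]]]]]; [|eauto].
      exists x, x. auto. }
    destruct L as [x' [Hx' E']].
    assert (Ex : x = x').
    { apply ext. intros d. split; intros Hd.
      - assert (Hda : d ∈ a) by now apply (ord_trans d x).
        destruct (IH d Hd Hda) as [Hdb Ed].
        destruct (proj1 (E (F d) (F x))) as [u [v [Hu [Hv [Huv [Eu Ev]]]]]].
        { exists d, x. auto. }
        assert (u = d) as -> by (apply IG; trivial; congruence).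
        assert (v = x') as -> by (apply IG; trivial; congruence).
        destruct Huv as [Huv|Huv]; trivial. subst d.
        assert (x' = x) as -> by (apply IF; trivial; congruence).
        destruct (mem_irrefl _ Hd).
      - assert (Hdb : d ∈ b) by now apply (ord_trans d x').
        destruct (proj2 (E (G d) (G x'))) as [u [v [Hu [Hv [Huv [Eu Ev]]]]]].
        { exists d, x'. auto. }
        assert (v = x) as -> by (apply IF; trivial; congruence).
        destruct Huv as [Huv|Huv].
        + destruct (IH u Huv Hu) as [Hub Eu'].
          assert (d = u) as -> by (apply IG; trivial; congruence). exact Huv.
        + subst u. assert (d = x') as -> by (apply IG; trivial; congruence).
          destruct (mem_irrefl _ Hd). }
    subst x'. auto. }
  intros x Hx. apply (K x (ord_mem a x Oa Hx) Hx).
Qed.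

Lemma coded_order (a b : V) (F G : V -> V) : op F -> op G ->
  is_ordinal a -> is_ordinal b ->
  (forall x y, x ∈ a -> y ∈ a -> F x = F y -> x = y) ->
  (forall x y, x ∈ b -> y ∈ b -> G x = G y -> x = y) ->
  same_order a b F G -> a = b.
Proof.
  intros DF DG Oa Ob IF IG E. apply ext. intros x. split.
  - exact (coded_order_subset a b F G DF DG Oa Ob IF IG E x).
  - refine (coded_order_subset b a G F DG DF Ob Oa IG IF _ x). intros i j. symmetry. apply E.
Qed.
End Sections.
#[export] Hint Resolve def_E1 : defdb.

(** * The transfinite sequence of reals attached to a sequence, and its length *)

Section Ranks.
Context {V : set_structure} {hV : ZF V}.
Context {R c : V} {E J : V -> V}.
Context (DE : op E) (DJ : op J) (E1R : forall A, E A ∈ R) (J1R : forall x, J x ∈ R).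
Context (E_inj : forall A B, A ∈ Pw om -> B ∈ Pw om -> E A = E B -> A = B).
Context (J_inj : forall x y, is_fun x om R -> is_fun y om R -> J x = J y -> x = y).
Context (Hc : proper_coloring R c).

(** [t] with its first [m] entries replaced by a fixed real. *)
Definition cut (t m : V) : V := lam om (fun n =>
  the (fun y => (n ∈ m /\ y = E emp) \/ (n ∉ m /\ y = ap t n))).

Lemma dt_cut l (s t : env V l -> V) : dt s -> dt t -> dt (fun g => cut (s g) (t g)).
Proof. defu cut. Qed.
Hint Resolve dt_cut : defdb.

Lemma ap_cut t m n : n ∈ om -> (n ∈ m -> ap (cut t m) n = E emp) /\
  (n ∉ m -> ap (cut t m) n = ap t n).
Proof.
  intros Hn. unfold cut. rewrite ap_lam by (defn || trivial).
  split; intros H; apply the_eq; auto; intros z [[K Ez]|[K Ez]]; tauto.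
Qed.

Lemma cut_fun t m : is_fun t om R -> is_fun (cut t m) om R.
Proof.
  intros Ht. apply is_fun_lam; [defn|]. intros n Hn.
  assert (K := ap_cut t m n Hn). unfold cut in K. rewrite ap_lam in K by (defn || trivial).
  destruct (classic (n ∈ m)) as [H|H].
  - rewrite (proj1 K H). apply E1R.
  - rewrite (proj2 K H). now apply (fun_in _ _ _ _ Ht).
Qed.

Lemma cut_0 t : is_fun t om R -> cut t emp = t.
Proof.
  intros Ht. apply (fun_ext _ _ om R R); [now apply cut_fun|trivial|].
  intros n Hn. apply (ap_cut t emp n Hn), mem_emp.
Qed.

(** Two successive cuts together replace the entries below the larger of the two bounds. *)
Lemma cut_cut t m k : is_fun t om R -> m ∈ om -> k ∈ om ->
  exists l, l ∈ om /\ cut (cut t m) k = cut t l.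
Proof.
  intros Ht Hm Hk. destruct (nat_max m k Hm Hk) as [l [Hl L]]. exists l. split; trivial.
  apply (fun_ext _ _ om R R); [now apply cut_fun, cut_fun|now apply cut_fun|].
  intros n Hn. destruct (ap_cut (cut t m) k n Hn) as [A1 A2].
  destruct (ap_cut t m n Hn) as [B1 B2], (ap_cut t l n Hn) as [C1 C2].
  destruct (classic (n ∈ k)) as [H|H].
  - rewrite A1, C1 by (trivial || apply L; auto). reflexivity.
  - rewrite A2 by trivial. destruct (classic (n ∈ m)) as [H'|H'].
    + rewrite B1, C1 by (trivial || apply L; auto). reflexivity.
    + rewrite B2, C2 by (trivial || rewrite L; tauto). reflexivity.
Qed.

Lemma E1_cut t m : is_fun t om R -> m ∈ om -> E1 R t (cut t m).
Proof.
  intros Ht Hm. apply E1P. split; [trivial|]. split; [now apply cut_fun|].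
  exists m. split; trivial. intros n Hn Nn. symmetry. now apply ap_cut.
Qed.

(** Related sequences agree from some [m] on, and the cut at [m] overwrites the entries before
    it. *)
Lemma E1_common_cut x y : E1 R x y -> exists m, m ∈ om /\ cut x m = cut y m.
Proof.
  intros H. apply E1P in H. destruct H as [Hx [Hy [m [Hm H]]]]. exists m. split; trivial.
  apply (fun_ext _ _ om R R); [now apply cut_fun|now apply cut_fun|].
  intros n Hn. destruct (ap_cut x m n Hn) as [A1 A2], (ap_cut y m n Hn) as [B1 B2].
  destruct (classic (n ∈ m)) as [K|K].
  - now rewrite A1, B1.
  - rewrite A2, B2 by trivial. auto.
Qed.

Definition col (u r : V) : V := ap c (opair (J u) r).

Lemma dt_col l (s t : env V l -> V) : dt s -> dt t -> dt (fun g => col (s g) (t g)).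
Proof. defu col. Qed.
Hint Resolve dt_col : defdb.

(** Here [W b] is a partial function from sequences to reals, for every [b ∈ a]. *)
Definition valid (a : V) (W : V -> V) (u t : V) : Prop :=
  (forall b, b ∈ a -> exists r, opair t r ∈ W b) /\
  forall b d, b ∈ a -> d ∈ a -> col u (ap (W b) t) = col u (ap (W d) t) -> b = d.

(** For a valid pair of cuts the colours carry a copy of the order of [a]. All valid pairs are
    recorded together, tagged by [n] and [m], so none has to be chosen. *)
Definition code (a : V) (W : V -> V) (t : V) : V := sep om (fun q =>
  exists n m b d, n ∈ om /\ m ∈ om /\ b ∈ a /\ d ∈ a /\ (b ∈ d \/ b = d) /\
    valid a W (cut t n) (cut t m) /\
    q = pr n (pr m (pr (col (cut t n) (ap (W b) (cut t m)))
                       (col (cut t n) (ap (W d) (cut t m)))))).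

(** The graph of a partial function on sequences, undefined at [t] when no pair of cuts of [t] is
    valid. It is a subset of a fixed product so that Separation applies. *)
Definition step (a : V) (W : V -> V) : V := sep (prod (Pw (prod om R)) R) (fun p =>
  exists t, is_fun t om R /\ p = opair t (E (code a W t)) /\
    exists n m, n ∈ om /\ m ∈ om /\ valid a W (cut t n) (cut t m)).

Lemma def_valid l (a u t : env V l -> V) (W : env V l -> V -> V) :
  dt a -> dt (fun g : env V (S l) => W (tl g) (hd g)) -> dt u -> dt t ->
  def (fun g => valid (a g) (W g) (u g) (t g)).
Proof. defu valid. Qed.
Hint Resolve def_valid : defdb.

Lemma dt_code l (a t : env V l -> V) (W : env V l -> V -> V) :
  dt a -> dt (fun g : env V (S l) => W (tl g) (hd g)) -> dt t ->
  dt (fun g => code (a g) (W g) (t g)).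
Proof. defu code. Qed.
Hint Resolve dt_code : defdb.

Lemma dt_step l (a : env V l -> V) (W : env V l -> V -> V) :
  dt a -> dt (fun g : env V (S l) => W (tl g) (hd g)) -> dt (fun g => step (a g) (W g)).
Proof. defu step. Qed.
Hint Resolve dt_step : defdb.

Lemma valid_ext a W W' : (forall b, b ∈ a -> W b = W' b) -> valid a W = valid a W'.
Proof.
  intros Ew. apply functional_extensionality; intros u.
  apply functional_extensionality; intros t. apply propositional_extensionality.
  unfold valid. split; intros [H1 H2]; (split;
    [intros b Hb; specialize (H1 b Hb)|intros b d Hb Hd; specialize (H2 b d Hb Hd)]);
    rewrite ?Ew in * by trivial; trivial.
Qed.

(** The recursion supplies only the terms with index in [a]; [step] looks at no others. *)
Lemma step_ext a W W' : op W -> op W' -> (forall b, b ∈ a -> W b = W' b) ->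
  step a W = step a W'.
Proof.
  intros DW DW' Ew.
  assert (Ec : code a W = code a W').
  { apply functional_extensionality. intros t. apply ext. intros q. unfold code.
    rewrite !mem_sep by defn. rewrite (valid_ext a W W' Ew).
    split; intros [Hq [n [m [b [d [Hn [Hm [Hb [Hd [Hbd [Hv K]]]]]]]]]]]; split; trivial;
      exists n, m, b, d; rewrite !Ew in * by trivial; repeat split; trivial; apply Hv. }
  apply ext. intros p. unfold step. rewrite !mem_sep by defn.
  now rewrite Ec, (valid_ext a W W' Ew).
Qed.

(** [ap (W a) t] is the [a]-th term of the transfinite sequence of reals attached to [t],
    where it is defined. *)
Definition W : V -> V := rec (fun a f => step a (ap f)).

Lemma op_W : op W.
Proof. unfold W. defn. Qed.
Hint Resolve op_W : defdb.

Lemma dt_W l (s : env V l -> V) : dt s -> dt (fun g => W (s g)).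
Proof. apply dt_op, op_W. Qed.
Hint Resolve dt_W : defdb.

Lemma W_eq a : is_ordinal a -> W a = step a W.
Proof.
  intros Ha. unfold W at 1. rewrite rec_eq; [|defn|trivial].
  apply step_ext; [defn|defn|]. intros b Hb. fold W. now rewrite ap_lam by (defn || trivial).
Qed.

Definition D (a t : V) : Prop := exists r, opair t r ∈ W a.

Lemma mem_W a t r : is_ordinal a -> opair t r ∈ W a <->
  is_fun t om R /\ r = E (code a W t) /\
  exists n m, n ∈ om /\ m ∈ om /\ valid a W (cut t n) (cut t m).
Proof.
  intros Ha. rewrite W_eq by trivial. unfold step. rewrite mem_sep by defn. split.
  - intros [_ [t' [Ht [Et K]]]]. apply opair_inj in Et. destruct Et as [-> ->]. auto.
  - intros [Ht [-> K]]. split; [|exists t; auto].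
    apply mem_prod. exists t, (E (code a W t)). split; [|split; [apply E1R|reflexivity]].
    apply mem_Pw. intros p Hp. apply mem_prod. destruct Ht as [H _].
    destruct (H p Hp) as [u [v [Hu [Hv Ep]]]]. apply is_opairP in Ep. eauto.
Qed.

Lemma D_iff a t : is_ordinal a -> is_fun t om R ->
  (D a t <-> exists n m, n ∈ om /\ m ∈ om /\ valid a W (cut t n) (cut t m)).
Proof.
  intros Ha Ht. unfold D. split.
  - intros [r Hr]. now apply mem_W in Hr.
  - intros K. exists (E (code a W t)). now apply mem_W.
Qed.

Lemma W_val a t : is_ordinal a -> D a t -> ap (W a) t = E (code a W t).
Proof.
  intros Ha [r Hr]. apply mem_W in Hr; trivial. destruct Hr as [H1 [_ H3]].
  apply ap_eq.
  - apply appE, mem_W; auto.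
  - intros z Hz. apply appE, mem_W in Hz; tauto.
Qed.

Lemma W_in a t : is_ordinal a -> D a t -> ap (W a) t ∈ R.
Proof. intros Ha Ht. rewrite W_val by trivial. apply E1R. Qed.

Lemma col_om a u t : is_ordinal a -> D a t -> col u (ap (W a) t) ∈ om.
Proof. intros Ha Ht. apply (proj1 Hc); [apply J1R|now apply W_in]. Qed.

Lemma mem_code a t n m i j : is_ordinal a -> n ∈ om -> m ∈ om -> i ∈ om -> j ∈ om ->
  pr n (pr m (pr i j)) ∈ code a W t <-> valid a W (cut t n) (cut t m) /\
    exists b d, b ∈ a /\ d ∈ a /\ (b ∈ d \/ b = d) /\
      i = col (cut t n) (ap (W b) (cut t m)) /\ j = col (cut t n) (ap (W d) (cut t m)).
Proof.
  intros Ha Hn Hm Hi Hj. unfold code. rewrite mem_sep by defn. split.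
  - intros [_ [n' [m' [b [d [Hn' [Hm' [Hb [Hd [Hbd [Hv Eq]]]]]]]]]]].
    assert (Cb : col (cut t n') (ap (W b) (cut t m')) ∈ om).
    { apply col_om; [exact (ord_mem a b Ha Hb)|exact (proj1 Hv b Hb)]. }
    assert (Cd : col (cut t n') (ap (W d) (cut t m')) ∈ om).
    { apply col_om; [exact (ord_mem a d Ha Hd)|exact (proj1 Hv d Hd)]. }
    assert (X := pr_om _ _ Hi Hj). assert (X' := pr_om _ _ Cb Cd).
    assert (Y := pr_om _ _ Hm X). assert (Y' := pr_om _ _ Hm' X').
    destruct (pr_inj _ _ _ _ Hn Y Hn' Y' Eq) as [<- E1'].
    destruct (pr_inj _ _ _ _ Hm X Hm' X' E1') as [<- E2'].
    destruct (pr_inj _ _ _ _ Hi Hj Cb Cd E2') as [-> ->].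
    split; [exact Hv|]. exists b, d. repeat split; trivial.
  - intros [Hv [b [d [Hb [Hd [Hbd [-> ->]]]]]]]. split; [repeat apply pr_om; trivial|].
    exists n, m, b, d. repeat split; trivial; apply Hv.
Qed.

Lemma code_om a t : code a W t ∈ Pw om.
Proof.
  apply mem_Pw. intros q Hq. unfold code in Hq. rewrite mem_sep in Hq by defn. tauto.
Qed.

(** A nonempty common code exhibits a pair of cuts valid for both ordinals, and the order it records
    on colours is isomorphic to each of them. *)
Lemma W_inj a a' t : is_ordinal a -> is_ordinal a' -> D a t -> D a' t ->
  ap (W a) t = ap (W a') t -> a = a'.
Proof.
  assert (K : forall a a' b, is_ordinal a -> is_ordinal a' -> D a t -> b ∈ a ->
    code a W t = code a' W t -> a = a').
  { clear a a'. intros a a' b0 Ha Ha' HD Hb0 Ec.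
    assert (Ht : is_fun t om R).
    { destruct HD as [r Hr]. now apply mem_W in Hr. }
    apply D_iff in HD; trivial. destruct HD as [n [m [Hn [Hm Hv]]]].
    set (F := fun b => col (cut t n) (ap (W b) (cut t m))).
    assert (F1 : forall a b, is_ordinal a -> valid a W (cut t n) (cut t m) -> b ∈ a -> F b ∈ om).
    { intros d b Hd Vd Hb. apply col_om; [exact (ord_mem d b Hd Hb)|exact (proj1 Vd b Hb)]. }
    (* A diagonal pair recorded for [a] is also recorded for [a'], so the same cuts are valid for
       [a']. *)
    assert (Hv' : valid a' W (cut t n) (cut t m)).
    { assert (L : pr n (pr m (pr (F b0) (F b0))) ∈ code a W t).
      { assert (Fb := F1 a b0 Ha Hv Hb0). apply mem_code; trivial. split; [exact Hv|].
        exists b0, b0. auto. }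
      rewrite Ec in L. apply mem_code in L; trivial; try exact (F1 a b0 Ha Hv Hb0).
      exact (proj1 L). }
    apply (coded_order a a' F F); trivial; try (unfold F; defn).
    - exact (proj2 Hv).
    - exact (proj2 Hv').
    - intros i j. split; intros [x [y [Hx [Hy [Hxy [-> ->]]]]]].
      + assert (X := F1 a x Ha Hv Hx). assert (Y := F1 a y Ha Hv Hy).
        assert (L : pr n (pr m (pr (F x) (F y))) ∈ code a W t).
        { apply mem_code; trivial. split; [exact Hv|]. exists x, y. auto. }
        rewrite Ec in L. apply mem_code in L; trivial. exact (proj2 L).
      + assert (X := F1 a' x Ha' Hv' Hx). assert (Y := F1 a' y Ha' Hv' Hy).
        assert (L : pr n (pr m (pr (F x) (F y))) ∈ code a' W t).
        { apply mem_code; trivial. split; [exact Hv'|]. exists x, y. auto. }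
        rewrite <- Ec in L. apply mem_code in L; trivial. exact (proj2 L). }
  intros Ha Ha' HD HD' Eq. rewrite !W_val in Eq by trivial.
  apply E_inj in Eq; try apply code_om.
  (* The argument [K] needs an element of one ordinal to make the code nonempty; if neither has one,
     both are empty. *)
  destruct (classic (exists b, b ∈ a)) as [[b Hb]|N].
  { exact (K a a' b Ha Ha' HD Hb Eq). }
  destruct (classic (exists b, b ∈ a')) as [[b Hb]|N'].
  { symmetry. exact (K a' a b Ha' Ha HD' Hb (eq_sym Eq)). }
  apply ext. intros z. split; intros Hz; [destruct N|destruct N']; eauto.
Qed.

Definition rho (t : V) : V := least (fun a => ~ D a t).

Lemma def_D l (s t : env V l -> V) : dt s -> dt t -> def (fun g => D (s g) (t g)).
Proof. defu D. Qed.
Hint Resolve def_D : defdb.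

Lemma op_rho : op rho.
Proof. unfold rho. defn. Qed.

Lemma dt_rho l (s : env V l -> V) : dt s -> dt (fun g => rho (s g)).
Proof. apply dt_op, op_rho. Qed.
Hint Resolve dt_rho : defdb.

(** If every term were defined, their distinctness would inject the ordinals into [R]. *)
Lemma rho_spec t : is_ordinal (rho t) /\ ~ D (rho t) t /\ forall b, b ∈ rho t -> D b t.
Proof.
  destruct (least_spec (fun a => ~ D a t)) as [H1 [H2 H3]].
  - defn.
  - apply NNPP. intros N.
    assert (K : forall a, is_ordinal a -> D a t).
    { intros a Ha. apply NNPP. intros L. apply N. eauto. }
    apply (no_ord_inj R (fun a => ap (W a) t)); [defn| |].
    + intros a Ha. apply W_in; auto.
    + intros a b Ha Hb. apply W_inj; auto.
  - split; [exact H1|]. split; [exact H2|]. intros b Hb. apply NNPP. exact (H3 b Hb).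
Qed.

(** A cut of a cut of [t] is a cut of [t], so every term defined at [cut t m] is defined at [t]. *)
Lemma rho_cut t m : is_fun t om R -> m ∈ om -> rho t ∉ rho (cut t m).
Proof.
  intros Ht Hm H. destruct (rho_spec t) as [O1 [N1 _]], (rho_spec (cut t m)) as [_ [_ H2]].
  apply N1. specialize (H2 _ H). apply D_iff in H2; trivial; [|now apply cut_fun].
  destruct H2 as [n [k [Hn [Hk Hv]]]]. apply D_iff; trivial.
  destruct (cut_cut t m n Ht Hm Hn) as [n' [Hn' En]].
  destruct (cut_cut t m k Ht Hm Hk) as [k' [Hk' Ek]].
  exists n', k'. rewrite <- En, <- Ek. auto.
Qed.

(** Without a collision the pair of [t], as its own cut at zero, and [cut t m] would be valid for
    [rho t], and the term of index [rho t] would exist at [t]. *)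
Lemma rho_collision t m : is_fun t om R -> m ∈ om -> rho (cut t m) = rho t ->
  exists b d, b ∈ rho t /\ d ∈ rho t /\ b <> d /\
    col t (ap (W b) (cut t m)) = col t (ap (W d) (cut t m)).
Proof.
  intros Ht Hm Er. destruct (rho_spec t) as [O1 [N1 _]], (rho_spec (cut t m)) as [_ [_ H2]].
  apply NNPP. intros N. apply N1, D_iff; trivial.
  exists emp, m. split; [exact emp_om|]. split; [exact Hm|]. rewrite cut_0 by trivial.
  rewrite Er in H2. split; [exact H2|].
  intros b d Hb Hd Eq. apply NNPP. intros Nbd. apply N. exists b, d. auto.
Qed.

(** Each smaller ordinal has a defined term, hence a valid pair whose colours inject it into the
    natural numbers. If [rho t] were uncountable it would be omega_1, and the terms would be an
    omega_1-sequence of distinct reals. *)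
Lemma rho_countable t : ~ (exists s, omega1_injection s R) -> is_fun t om R ->
  countable (rho t).
Proof.
  intros N1 Ht. apply NNPP. intros Nc. destruct (rho_spec t) as [O1 [_ H1]].
  apply N1. exists (lam (rho t) (fun b => ap (W b) t)), (rho t).
  assert (HF : is_fun (lam (rho t) (fun b => ap (W b) t)) (rho t) R).
  { apply is_fun_lam; [defn|]. intros b Hb. apply W_in; auto. exact (ord_mem _ b O1 Hb). }
  split; [split; [exact O1|split; [exact Nc|]]|split; [exact HF|]].
  - intros a Ha. assert (Oa := ord_mem _ a O1 Ha).
    assert (Da := H1 a Ha). apply D_iff in Da; trivial.
    destruct Da as [n [m [Hn [Hm Hv]]]].
    apply (countable_intro a (fun b => col (cut t n) (ap (W b) (cut t m)))).
    + defn.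
    + intros b Hb. apply col_om; [exact (ord_mem a b Oa Hb)|exact (proj1 Hv b Hb)].
    + exact (proj2 Hv).
  - apply (injectiveP _ _ _ HF). intros a b Ha Hb. rewrite !ap_lam by (defn || trivial).
    exact (W_inj a b t (ord_mem _ a O1 Ha) (ord_mem _ b O1 Hb) (H1 a Ha) (H1 b Hb)).
Qed.

(** If [x] and [y] have the same minimal rank then so has a common tail [cut x m], hence [y] is
    determined by [x], [m], a collision [b, d] and its colour. *)
Lemma section_of_rho : ~ (exists s, omega1_injection s R) ->
  exists S, complete_countable_section R S.
Proof.
  intros N1. apply (section_of_rank R rho op_rho).
  { intros x _. apply rho_spec. }
  intros x Hx Mx.
  destruct (countable_elim _ (rho_countable x N1 Hx)) as [g [G1 G2]].
  (* [q] codes a cut, two indices below [rho x] and the colour they share in the row of [y]. The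
     condition on the rank of the cut guarantees that both terms exist there. *)
  set (P := fun y q => exists m b d, m ∈ om /\ b ∈ rho x /\ d ∈ rho x /\ b <> d /\
    rho (cut x m) = rho x /\
    col y (ap (W b) (cut x m)) = col y (ap (W d) (cut x m)) /\
    q = pr m (pr (ap g b) (pr (ap g d) (col y (ap (W b) (cut x m)))))).
  set (I := sep (Pw (prod om R)) (fun y => E1 R x y /\ exists q, q ∈ om /\ P y q)).
  assert (HI : forall y, y ∈ I <-> E1 R x y /\ exists q, q ∈ om /\ P y q).
  { intros y. unfold I. rewrite mem_sep by (unfold P; defn). split; [tauto|].
    intros H. split; trivial. apply mem_Pw. intros p Hp. apply mem_prod.
    destruct H as [H _]. apply E1P in H. destruct H as [_ [[H _] _]].
    destruct (H p Hp) as [u [v [Hu [Hv Ep]]]]. apply is_opairP in Ep. eauto. }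
  exists I. split.
  - apply (countable_rel I P).
    + unfold P. defn.
    + intros y Hy. now apply HI.
    + intros y z q Hy Hz _ Py Pz. apply HI in Hy. apply HI in Hz.
      destruct Hy as [Hy _], Hz as [Hz _]. apply E1P in Hy. apply E1P in Hz.
      apply J_inj; [tauto|tauto|].
      destruct Py as [m [b [d [Hm [Hb [Hd [Nbd [Er [Ey Eq]]]]]]]]].
      destruct Pz as [m' [b' [d' [Hm' [Hb' [Hd' [_ [Er' [Ez Eq']]]]]]]]].
      destruct (rho_spec (cut x m)) as [Or [_ Dr]]. rewrite Er in Or, Dr.
      assert (Ob := ord_mem _ b Or Hb). assert (Od := ord_mem _ d Or Hd).
      destruct (rho_spec (cut x m')) as [_ [_ Dr']].
      assert (C1 : col y (ap (W b) (cut x m)) ∈ om) by (apply col_om; auto).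
      assert (L : m = m' /\ b = b' /\ d = d' /\
        col y (ap (W b) (cut x m)) = col z (ap (W b') (cut x m'))).
      { rewrite Eq in Eq'.
        assert (C2 : col z (ap (W b') (cut x m')) ∈ om).
        { apply col_om; [exact (ord_mem _ b' Or Hb')|]. apply Dr'. rewrite Er'; trivial. }
        assert (X := pr_om _ _ (G1 d Hd) C1). assert (X' := pr_om _ _ (G1 d' Hd') C2).
        assert (Y := pr_om _ _ (G1 b Hb) X). assert (Y' := pr_om _ _ (G1 b' Hb') X').
        destruct (pr_inj _ _ _ _ Hm Y Hm' Y' Eq') as [Em E1'].
        destruct (pr_inj _ _ _ _ (G1 b Hb) X (G1 b' Hb') X' E1') as [Eb E2'].
        destruct (pr_inj _ _ _ _ (G1 d Hd) C1 (G1 d' Hd') C2 E2') as [Ed E3'].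
        auto. }
      destruct L as [<- [<- [<- L]]].
      (* With the same [q], the rows of [y] and [z] show one colour at the same two distinct reals,
         so the colouring identifies [J y] and [J z]. *)
      refine (proj2 Hc (J y) (J z) (ap (W b) (cut x m)) (ap (W d) (cut x m)) (J1R y) (J1R z)
        (W_in b _ Ob (Dr b Hb)) (W_in d _ Od (Dr d Hd)) _ Ey Ez L).
      intros K. apply Nbd. exact (W_inj b d (cut x m) Ob Od (Dr b Hb) (Dr d Hd) K).
  - intros y Hy My. apply HI. split; [exact Hy|].
    destruct (E1_common_cut x y Hy) as [m [Hm Em]].
    assert (Hyf : is_fun y om R) by now apply E1P in Hy.
    assert (Eyx : rho y = rho x).
    { destruct (ord_tri (rho y) (rho x)) as [T|[T|T]]; trivial; try apply rho_spec.
      - destruct (Mx y Hy T).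
      - destruct (My x (E1_sym R x y Hy) T). }
    (* Cutting does not raise the rank, and the minimality of [x] forbids lowering it. *)
    assert (Er : rho (cut x m) = rho x).
    { destruct (ord_tri (rho (cut x m)) (rho x)) as [T|[T|T]]; trivial; try apply rho_spec.
      - destruct (Mx (cut x m) (E1_cut x m Hx Hm) T).
      - destruct (rho_cut x m Hx Hm T). }
    (* The collision is taken for [y] along the tail it shares with [x], so the two reals depend
       only on [x], [m] and the indices. *)
    destruct (rho_collision y m Hyf Hm) as [b [d [Hb [Hd [Nbd Eq]]]]].
    { rewrite <- Em. congruence. }
    rewrite Eyx in Hb, Hd. rewrite <- Em in Eq.
    exists (pr m (pr (ap g b) (pr (ap g d) (col y (ap (W b) (cut x m)))))).
    split; [|exists m, b, d; auto 10].
    destruct (rho_spec (cut x m)) as [Or [_ Dr]]. rewrite Er in Or, Dr.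
    repeat apply pr_om; auto. apply col_om; auto. exact (ord_mem _ b Or Hb).
Qed.
End Ranks.

(** * Enumeration of the reals and a section of E_1 from a countable colouring *)

Theorem theorem6p2 (V : set_structure) (hV : ZF V) (R : V) (hR : is_reals R)
    (hchi : Gamma_countably_chromatic R) :
  ((exists s : V, omega1_injection s R) ->
   (exists s : V, omega1_injection s R /\ onto s R)) /\
  (exists S : V, complete_countable_section R S).
Proof.
  split; [exact (reals_omega1 R hchi)|].
  destruct (reals_coding R hR) as [E [J [DE [DJ [E1R [J1R [E_inj J_inj]]]]]]].
  (* With an omega_1-sequence the reals are enumerated and [J] ranks all sequences; without one,
     every [rho] is countable. *)
  destruct (classic (exists s, omega1_injection s R)) as [H|H].
  - destruct (reals_omega1 R hchi H) as [s [Hs Ho]].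
    exact (section_of_enumeration R s J DJ J1R J_inj Hs Ho).
  - destruct (proper_coloring_exists R hchi) as [c Hc].
    exact (section_of_rho DE DJ E1R J1R E_inj J_inj Hc H).
Qed.
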